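(* Let $X$ be a centered Gaussian process with canonical metric $\delta^2(s,t):=\mathbf{E}[(X_t-X_s)^2]$, covariance $Q(s,t)=\mathbf{E}[X_sX_t]$ and variance $Q_u:=\mathrm{Var}[X_u]$. Assume: - There is a univariate increasing and concave function, also denoted $\delta^2$ (with $\delta\ge0$), such that $\delta(r)=o\left(r^{1/6}\right)$ for $r$ near $0$ and $\delta^2(s,t)\le\delta^2(|t-s|)$ for all $s,t$. - In the sense of distributions, the mixed second derivative $\partial^2\delta^2/(\partial s\,\partial t)$ of the bivariate $\delta^2$ is a signed $\sigma$-finite measure $\mu$ off the diagonal, and for some constant $C$ and all $\varepsilon>0$ small enough, $|\mu|\left(\{(s,t):0\le s\le t-\varepsilon\le1\}\right)\le C\,\varepsilon^{-2/3}$, where $|\mu|$ is the total variation measure of $\mu$. - For $u<v$, the functions $u\mapsto Q_u$, $v\mapsto\delta^2(u,v)$ and $u\mapsto-\delta^2(u,v)$ are increasing and concave. - There exist positive constants $a>1$, $b<1/2$, $c>1/4$ and $c'>0$ such that, for all small $\varepsilon>0$ and all $\varepsilon<u<v\le1$, (i) $c\,\delta^2(u)\le Q_u$; (ii) $c'\,\delta^2(u)\,\delta^2(v-u)\le Q_uQ_v-Q^2(u,v)$; (iii) $\displaystyle\frac{\delta(au)-\delta(u)}{(a-1)u}<b\,\frac{\delta(u)}{u}$. Then for every $f\in C^6(\mathbf{R})$ and every $t\in[0,1]$, the symmetric (generalized Stratonovich) integral $$\int_0^tf'(X_u)\,d^\circ X_u:=\lim_{\varepsilon\to0}\frac1\varepsilon\int_0^tdu\,(X_{u+\varepsilon}-X_u)\,\frac12\left(f'(X_{u+\varepsilon})+f'(X_u)\right)$$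 exists (as a limit in probability), and the It\^o formula $$f(X_t)=f(X_0)+\int_0^tf'(X_u)\,d^\circ X_u$$ holds.
   Context: Fix $\varepsilon_0>0$. The process $X$ is indexed by $[0,1+\varepsilon_0]$, so that $X_{u+\varepsilon}$ makes sense for $u\in[0,1]$ and $0<\varepsilon\le\varepsilon_0$; the bivariate $\delta^2$ is defined on $[0,1+\varepsilon_0]^2$, the univariate $\delta^2$ on $[0,1+\varepsilon_0]$, and $\mu$ lives on $[0,1+\varepsilon_0]^2\setminus\{(s,s)\}$. In (i)-(iii), a one-argument $\delta$ is the univariate function and (iii) is required whenever $au$ lies in its domain. It is a standing assumption that $X$ is represented as $X_t=\int_0^{1+\varepsilon_0}G(t,s)\,dW(s)$ with $W$ a standard Brownian motion and $G$ a non-random measurable kernel with $G(t,\cdot)$ square-integrable for every $t$. *)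

(* Defs.v *)
From HB Require Import structures.
From mathcomp Require Import all_boot all_order all_algebra.
From mathcomp Require Import all_classical all_reals all_analysis.

Set Implicit Arguments.
Unset Strict Implicit.
Unset Printing Implicit Defensive.

Import Order.TTheory GRing.Theory Num.Theory.
Import numFieldNormedType.Exports.

Local Open Scope classical_set_scope.
Local Open Scope ring_scope.

Section RealFunctions.
Context {R : realType}.
Implicit Types (D : set R) (f : R -> R).

(* "Increasing" is meant in the wide sense. *)
Definition increasing_on D f := {in D &, {homo f : x y / x <= y}}.

Definition concave_on D f := convex_function (E := R^o) D (fun x => - f x).

Definition Cn n f :=
  (forall k x, (k < n)%N -> derivable (f^`(k))%classic x 1) /\
  continuous (f^`(n))%classic.

End RealFunctions.

Section Gaussian.
Context d (Omega : measurableType d) (R : realType) (P : probability Omega R).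
Implicit Types (X W : R -> {RV P >-> R}) (Y : Omega -> R).

(* [normal_prob m 0] is not the Dirac mass at [m] but the uniform law on
   [0, 1], hence the case distinction. *)
Definition normal_rv Y (m sigma : R) :=
  forall A : set R, measurable A ->
    P (Y @^-1` A) = if sigma == 0 then \d_m A else normal_prob m sigma A.

Definition gaussian_process (T : R) X :=
  forall n (t c : 'I_n -> R), (forall i, t i \in `[0, T]) ->
    exists m sigma, normal_rv (fun w => \sum_(i < n) c i * X (t i) w) m sigma.

Definition centered_gaussian_process (T : R) X :=
  gaussian_process T X /\ forall t, t \in `[0, T] -> 'E_P[X t]%E = 0%E.

Definition covar X (s t : R) : R := fine 'E_P[fun w => (X s w * X t w)%R]%E.

Definition var X (u : R) : R := fine 'V_P[X u]%E.

(* The square of the canonical metric. *)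
Definition delta2 X (s t : R) : R :=
  fine 'E_P[fun w => ((X t w - X s w) ^+ 2)%R]%E.

(* Letting some of the [A i] be the whole line gives the product rule for all
   subfamilies. *)
Definition independent n (Y : nat -> Omega -> R) :=
  forall A : nat -> set R, (forall i, measurable (A i)) ->
    P (\bigcap_(i in `I_n) (Y i @^-1` A i)) =
    (\prod_(i < n) P (Y i @^-1` A i))%E.

Definition brownian_motion (T : R) W :=
  [/\ {ae P, forall w, W 0 w = 0},
      forall s t, 0 <= s -> s <= t -> t <= T ->
        normal_rv (fun w => W t w - W s w) 0 (Num.sqrt (t - s)),
      forall n (t : nat -> R), 0 <= t 0%N -> t n <= T ->
        (forall i, (i < n)%N -> t i <= t i.+1) ->
        independent n (fun i w => W (t i.+1) w - W (t i) w) &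
      {ae P, forall w, {within `[0, T], continuous (fun t => W t w)}}].

(* A list of triples (c, a, b) encodes the step function
   \sum c 1_(]a, b]) on [0, T]. *)
Definition step_data (T : R) (p : seq (R * R * R)) :=
  all (fun q => [&& 0 <= q.1.2, q.1.2 <= q.2 & q.2 <= T]) p.

Definition step_fun (p : seq (R * R * R)) (x : R) : R :=
  \sum_(q <- p) q.1.1 * \1_(`]q.1.2, q.2]%classic) x.

Definition step_integral W (p : seq (R * R * R)) (w : Omega) : R :=
  \sum_(q <- p) q.1.1 * (W q.2 w - W q.1.2 w).

(* [Y] is (a version of) the integral of [g] over [0, T] with respect to [W]:
   the isometric extension of [step_integral] from step functions to
   L^2([0, T]). *)
Definition wiener_integral (T : R) W (g : R -> R) Y :=
  exists p : nat -> seq (R * R * R),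
    [/\ forall n, step_data T (p n),
        (\int[lebesgue_measure]_(s in `[0%R, T])
           ((step_fun (p n) s - g s) ^+ 2)%:E)%E @[n --> \oo] --> 0%E &
        'E_P[fun w => ((step_integral W (p n) w - Y w) ^+ 2)%R]%E
          @[n --> \oo] --> 0%E].

Definition cvg_in_probability (F : set_system R) (Y : R -> Omega -> R)
    (I : Omega -> R) :=
  forall eta : R, 0 < eta ->
    P [set w | eta <= `|Y e w - I w|] @[e --> F] --> 0%E.

Definition symmetric_sum X (g : R -> R) (t e : R) (w : Omega) : R :=
  e^-1 * \int[lebesgue_measure]_(u in `[0, t])
    ((X (u + e) w - X u w) * (2^-1 * (g (X (u + e) w) + g (X u w)))).

(* [I] is the integral of [g (X u)] against d°X u over [0, t]; it is unique up
   to almost sure equality. *)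
Definition symmetric_integral X (g : R -> R) (t : R) (I : {RV P >-> R}) :=
  cvg_in_probability 0^'+ (symmetric_sum X g t) I.

End Gaussian.

(* A signed sigma-finite measure may take both values +oo and -oo on different
   sets, so it need not be defined on every measurable set as a charge is; it
   is given by its Jordan decomposition. *)
Record signed_measure d (T : measurableType d) (R : realType) := SignedMeasure {
  pos_part : {sigma_finite_measure set T -> \bar R} ;
  neg_part : {sigma_finite_measure set T -> \bar R} ;
  mutually_singular : exists A : set T,
    [/\ measurable A, pos_part (~` A) = 0%E & neg_part A = 0%E] }.

Definition variation_measure d (T : measurableType d) (R : realType)
    (mu : signed_measure T R) : {measure set T -> \bar R} :=
  measure_add (pos_part mu) (neg_part mu).

Section Distributions.
Context {R : realType}.
Implicit Types (phi h : R * R -> R).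

Definition dx phi : R * R -> R :=
  'D_((1, 0) : R^o * R^o) (phi : R^o * R^o -> R^o).
Definition dy phi : R * R -> R :=
  'D_((0, 1) : R^o * R^o) (phi : R^o * R^o -> R^o).

Fixpoint C2n n phi : Prop :=
  if n is n'.+1 then
    (forall p, derivable (phi : R^o * R^o -> R^o) p (1, 0) /\
               derivable (phi : R^o * R^o -> R^o) p (0, 1)) /\
    C2n n' (dx phi) /\ C2n n' (dy phi)
  else continuous phi.

Definition test_function (U : set (R * R)) phi :=
  (forall n, C2n n phi) /\
  exists K, [/\ compact K, K `<=` U & forall p, ~ K p -> phi p = 0].

Definition off_diagonal_square (T : R) : set (R * R) :=
  [set p | [/\ p.1 \in `[0, T], p.2 \in `[0, T] & p.1 != p.2]].

Definition open_off_diagonal_square (T : R) : set (R * R) :=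
  [set p | [/\ p.1 \in `]0, T[, p.2 \in `]0, T[ & p.1 != p.2]].

(* On the square [0, T]^2 off the diagonal, the distribution d^2 h / (ds dt) is
   the signed measure [mu].  The integrability clause is what makes [mu] a
   distribution there. *)
Definition mixed_derivative_off_diagonal (T : R) h
    (mu : signed_measure (R * R)%type R) :=
  variation_measure mu (~` off_diagonal_square T) = 0%E /\
  forall phi, test_function (open_off_diagonal_square T) phi ->
    (variation_measure mu).-integrable setT (EFin \o phi) /\
    \int[(lebesgue_measure \x lebesgue_measure)%E]_(p in `[0, T] `*` `[0, T])
      (h p * dx (dy phi) p) =
    \int[pos_part mu]_p phi p - \int[neg_part mu]_p phi p.

End Distributions.

(* Main.v *)
Require Import Defs.
From HB Require Import structures.
From mathcomp Require Import all_boot all_order all_algebra.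
From mathcomp Require Import all_classical all_reals all_analysis.
From mathcomp Require Import measurable_realfun ring lra.

Set Implicit Arguments.
Unset Strict Implicit.
Unset Printing Implicit Defensive.

Import Order.TTheory GRing.Theory Num.Theory.
Import numFieldNormedType.Exports.

Local Open Scope classical_set_scope.
Local Open Scope ring_scope.

(** The symmetric sum is a time average of trapezoidal approximations
    [(y - x) (f' y + f' x) / 2] of the increments [f y - f x], with
    [x = X u] and [y = X (u + e)].  The averages of the exact increments
    telescope: [e^-1 \int_0^t (f (X (u + e)) - f (X u)) du] is the mean of
    [f (X u)] over the interval from [t] to [t + e] minus its mean over the one
    from [0] to [e], so it tends to [f (X t) - f (X 0)].  The trapezoidal rule
    is exact up to the cube of the step ([trapezoid_error]), so all that has to be shown is that
    [e^-1 \int_0^t |X (u + e) - X u|^3 du] tends to 0; the limit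
    [I = f (X t) - f (X 0)] then exists and satisfies the Ito formula.

    This holds as soon as [E (X_t - X_s)^4 <= K (t - s)^2], because then the
    average of the cubes is of order [sqrt e].  The hypotheses on the metric
    force such a bound ([canonical_metric_linear]).  Since [u |-> - delta2 u v] is
    concave, [delta2 _ v] is a convex function on the interval from [0] to
    [v]; it vanishes at [v], so it lies below its chord:
    [delta2 u v <= (1 - u / v) delta2 0 v].
    On the other hand the Gram determinant [Q_u Q_v - Q(u, v)^2] is at most
    [Q_u delta2 u v] ([gram_le]), so (ii), at one fixed [u] where (iii) gives
    [delta u <> 0], yields [delta r ^ 2 <= K r].  For Gaussian increments
    this bound on the second moment passes to the fourth
    ([normal_rv_fourth_moment_le]).

    The derivatives of [f] are bounded only on bounded sets, and the paths of
    [X] are merely measurable in time.  A dyadic chaining argument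
    ([path_bound]) gives, off an event of small probability, a bound [M] on
    [X u] that is almost sure for each [u].  On that event, by Fubini, [X]
    may be replaced by its truncation at level [M] ([sym_sum_clip]); for a
    bounded process the deviation of the symmetric sum tends to 0 in [L^1]
    ([sym_sum_bounded_L1]), and Markov's inequality concludes. *)

(** * Mean value estimates and the trapezoidal rule *)

Section RealAnalysis.
Context {R : realType}.
Implicit Types (f : R -> R) (a b x y M L H : R).

Lemma mean_value_ineq f df L a b :
  (forall x, is_derive x 1 f (df x)) ->
  (forall x, Num.min a b <= x <= Num.max a b -> `|df x| <= L) ->
  `|f b - f a| <= L * `|b - a|.
Proof.
move=> dfE dfL.
have cf : continuous f.
  move=> x; apply/differentiable_continuous/derivable1_diffP.
  by have [] := dfE x.
have [ab|ba] := leP a b.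
- have [c /[!in_itv]/= cab ->] := MVT_segment ab
    (fun x _ => dfE x) (continuous_subspaceT cf).
  by rewrite normrM ler_wpM2r// dfL// min_l// max_r.
- have [c /[!in_itv]/= cba E] := MVT_segment (ltW ba)
    (fun x _ => dfE x) (continuous_subspaceT cf).
  rewrite distrC E normrM [`|b - a|]distrC ler_wpM2r// dfL//.
  by rewrite min_r 1?max_l// ltW.
Qed.

Lemma norm_le_segment M a b x : `|a| <= M -> `|b| <= M ->
  Num.min a b <= x <= Num.max a b -> `|x| <= M.
Proof. by rewrite !ler_norml; have [] := leP a b; lra. Qed.

Lemma dist_le_segment a b x :
  Num.min a b <= x <= Num.max a b -> `|x - a| <= `|b - a|.
Proof.
have [ab|ba] := leP a b => /andP[h1 h2].
- by rewrite !ger0_norm ?subr_ge0 ?lerB.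
- rewrite distrC [`|b - a|]distrC !ger0_norm ?subr_ge0 ?lerB//.
  exact: ltW.
Qed.

(** The difference between the increment of [f] and its trapezoidal
    approximation, as a function of the right end [x], vanishes at [a] and has
    derivative half of [f1 x - f1 a - (x - a) * f2 x], which two applications
    of the mean value inequality bound by [H * |b - a| ^ 2]. *)
Lemma trapezoid_error f f1 f2 f3 M H a b :
  (forall x, is_derive x 1 f (f1 x)) ->
  (forall x, is_derive x 1 f1 (f2 x)) ->
  (forall x, is_derive x 1 f2 (f3 x)) ->
  (forall x, `|x| <= M -> `|f3 x| <= H) ->
  `|a| <= M -> `|b| <= M ->
  `|f b - f a - (b - a) * (2^-1 * (f1 b + f1 a))| <= H * `|b - a| ^+ 3.
Proof.
move=> df df1 df2 f3H aM bM.
have H0 : 0 <= H by rewrite (le_trans _ (f3H _ aM)).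
pose phi x := f x - f a - (x - a) * (2^-1 * (f1 x + f1 a)).
pose dphi x := 2^-1 * (f1 x - x * f2 x - (f1 a - a * f2 x)).
have phiE x : is_derive x 1 phi (dphi x).
  have d := df x; have d1 := df1 x.
  apply: is_derive_eq.
  by rewrite /GRing.scale/= /dphi; field.
have -> : f b - f a - (b - a) * (2^-1 * (f1 b + f1 a)) = phi b - phi a.
  by rewrite /phi; ring.
rewrite exprSr mulrA.
apply: (mean_value_ineq phiE) => x xab.
have xM := norm_le_segment aM bM xab.
have xa := dist_le_segment xab.
(* The derivative of g is f2 y - f2 x. *)
pose g y := f1 y - y * f2 x.
have gE y : is_derive y 1 g (f2 y - f2 x).
  by have d1 := df1 y; apply: is_derive_eq; rewrite /GRing.scale/=; ring.
have : `|g x - g a| <= H * `|b - a| * `|x - a|.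
  apply: (mean_value_ineq gE) => y yax.
  have yM := norm_le_segment aM xM yax.
  have : `|f2 y - f2 x| <= H * `|y - x|.
    apply: (mean_value_ineq df2) => z zxy.
    exact/f3H/(norm_le_segment xM yM zxy).
  move/le_trans; apply; apply: ler_wpM2l => //.
  apply: le_trans xa; rewrite [`|x - a|]distrC.
  by apply: dist_le_segment; rewrite minC maxC.
rewrite /dphi -/(g x) -/(g a) normrM => gxa.
rewrite (_ : `|2^-1| = 2^-1); last by rewrite ger0_norm// invr_ge0.
have : H * `|b - a| * `|x - a| <= H * `|b - a| ^+ 2.
  by rewrite expr2 mulrA ler_wpM2l// mulr_ge0.
have := normr_ge0 (g x - g a); lra.
Qed.

(** With [norm_le_fourth], this reduces the first and third absolute moments
    to the fourth.  The free parameter [s] is the scale of [x]; it is taken of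
    order [sqrt e] for increments over a time [e]. *)
Lemma cube_le (s x : R) : 0 < s -> `|x| ^+ 3 <= s ^+ 3 + x ^+ 4 / s.
Proof.
move=> s0; have x4 : x ^+ 4 = `|x| ^+ 4 by rewrite -normrX ger0_norm// exprn_even_ge0.
have [xs|/ltW sx] := leP `|x| s.
  by rewrite ler_wpDr ?lerXn2r ?nnegrE ?(ltW s0)// x4 divr_ge0// ltW.
by rewrite ler_wpDl ?exprn_ge0 ?(ltW s0)// x4 ler_pdivlMr// [leRHS]exprSr ler_wpM2l// exprn_ge0.
Qed.

Lemma norm_le_fourth (s x : R) : 0 < s -> `|x| <= s + x ^+ 4 / s ^+ 3.
Proof.
move=> s0; have x4 : x ^+ 4 = `|x| ^+ 4 by rewrite -normrX ger0_norm// exprn_even_ge0.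
have [xs|/ltW sx] := leP `|x| s.
  by rewrite ler_wpDr// x4 divr_ge0 ?exprn_ge0// ltW.
rewrite ler_wpDl ?(ltW s0)// x4 ler_pdivlMr ?exprn_gt0// [leRHS]exprS ler_wpM2l//.
by rewrite lerXn2r ?nnegrE// ltW.
Qed.

Lemma continuous_norm_ub f M : continuous f ->
  exists H, forall x, `|x| <= M -> `|f x| <= H.
Proof.
move=> cf; have [M0|M0] := leP 0 M; last first.
  by exists 0 => x; rewrite leNgt (lt_le_trans M0).
have cnf : continuous (fun x => `|f x|).
  by move=> x; apply: cvg_norm; exact: cf.
have [|c _ cmax] := @EVT_max _ (fun x => `|f x|) (- M) M _ (continuous_subspaceT cnf).
  by rewrite ge0_cp.
by exists `|f c| => x xM; apply: cmax; rewrite in_itv/= -ler_norml.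
Qed.

Lemma Cn_is_derive n f k : Cn n f -> (k < n)%N ->
  forall x, is_derive x 1 (f^`(k))%classic (f^`(k.+1)%classic x).
Proof. by move=> [df _] kn x; rewrite derive1nS derive1E; exact/derivableP/df. Qed.

Lemma is_derive_continuous f df : (forall x, is_derive x 1 f (df x)) -> continuous f.
Proof.
move=> dfE x; apply/differentiable_continuous/derivable1_diffP.
by have [] := dfE x.
Qed.

End RealAnalysis.

(** * Moments of Gaussian variables *)

Section GaussianMoments.
Context {R : realType}.
Local Notation leb := (@lebesgue_measure R).
Implicit Types (m s : R).

(** The density of the normal law is its Radon-Nikodym derivative, whence the
    formula for the integral of an arbitrary nonnegative function. *)
Lemma ge0_integral_normal_prob m s (g : R -> \bar R) :
  measurable_fun setT g -> (forall x, 0 <= g x)%E ->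
  (\int[normal_prob m s]_x g x = \int[leb]_x (g x * (normal_pdf m s x)%:E))%E.
Proof.
move=> mg g0; have dom := normal_prob_dominates m s.
rewrite -(Radon_Nikodym_SigmaFinite.change_of_variables dom)//.
apply: ae_eq_integral => //.
- apply: emeasurable_funM => //.
  exact: measurable_int (Radon_Nikodym_SigmaFinite.f_integrable dom).
- apply: emeasurable_funM => //.
  by apply/measurable_EFinP; exact: measurable_normal_pdf.
have RNE : ae_eq leb setT
    (Radon_Nikodym_SigmaFinite.f (normal_prob m s) lebesgue_measure)
    (fun x => (normal_pdf m s x)%:E); last first.
  by apply: filterS RNE => x h /h ->.
apply: integral_ae_eq => //.
- exact: (Radon_Nikodym_SigmaFinite.f_integrable dom).
- by apply/measurable_EFinP; exact: measurable_normal_pdf.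
- by move=> A _ mA; rewrite -Radon_Nikodym_SigmaFinite.f_integral.
Qed.

(** Doubling the standard deviation makes the density decay slowly enough to
    absorb the factor [(x - m) ^ 4]; the fourth moment is then bounded by the
    total mass of the wider law. *)
Lemma normal_pdf_fourth_le m s x : s != 0 ->
  (x - m) ^+ 4 * normal_pdf m s x <= 64 * s ^+ 4 * normal_pdf m (2 * s) x.
Proof.
move=> s0; have s20 : 2 * s != 0 by rewrite mulf_neq0.
rewrite !normal_pdfE//.
have s2 : 0 < s ^+ 2 by rewrite exprn_even_gt0.
have peakE : normal_peak s = 2 * normal_peak (2 * s).
  rewrite /normal_peak exprMn -[in RHS]mulrA -[in RHS]mulrnAr sqrtrM// sqrtr_sqr.
  by rewrite ger0_norm// invfM mulrA divff// mul1r.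
rewrite peakE; set p := normal_peak (2 * s).
have p0 : 0 <= p by exact: normal_peak_ge0.
(* exp z is the ratio of the two Gaussian exponentials. *)
set z := 3 * (x - m) ^+ 2 / (8 * s ^+ 2).
have z0 : 0 <= z by rewrite /z divr_ge0// mulr_ge0// ?sqr_ge0.
have E : normal_fun m (2 * s) x = expR z * normal_fun m s x.
  rewrite /normal_fun -expRD; congr expR; rewrite /z exprMn.
  by field; rewrite s0.
have zexp : (z / 2) ^+ 2 <= expR z.
  rewrite {2}(_ : z = z / 2 + z / 2); last by lra.
  have z20 : 0 <= z / 2 by apply: divr_ge0.
  rewrite expRD -expr2 lerXn2r ?nnegrE ?expR_ge0//.
  by rewrite (le_trans _ (expR_ge1Dx _))// lerDr.
have : (x - m) ^+ 4 <= 32 * s ^+ 4 * expR z.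
  apply: (@le_trans _ _ (32 * s ^+ 4 * (z / 2) ^+ 2)).
    rewrite (_ : 32 * s ^+ 4 * (z / 2) ^+ 2 = (9 / 8) * (x - m) ^+ 4).
      have := @exprn_even_ge0 R 4 (x - m) isT; lra.
    by rewrite /z; field.
  by apply: ler_wpM2l => //; rewrite mulr_ge0// exprn_even_ge0.
rewrite E => h.
rewrite (_ : 64 * s ^+ 4 * (p * (expR z * normal_fun m s x)) =
  (32 * s ^+ 4 * expR z) * (2 * p * normal_fun m s x)); last by ring.
by apply: ler_wpM2r => //; rewrite !mulr_ge0// normal_fun_ge0.
Qed.

Lemma normal_prob_fourth_central m s : s != 0 ->
  (\int[normal_prob m s]_x ((x - m) ^+ 4)%:E <= (64 * s ^+ 4)%:E)%E.
Proof.
move=> s0; rewrite ge0_integral_normal_prob//; last 2 first.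
- by apply/measurable_EFinP; apply: measurable_funX; exact: measurable_funB.
- by move=> x; rewrite lee_fin exprn_even_ge0.
apply: (@le_trans _ _ (\int[leb]_x ((64 * s ^+ 4)%:E * (normal_pdf m (2 * s) x)%:E)%E)%E).
  apply: ge0_le_integral => //=.
  - move=> x _; rewrite -EFinM lee_fin mulr_ge0 ?normal_pdf_ge0//.
    by rewrite exprn_even_ge0.
  - apply: emeasurable_funM; last first.
      by apply/measurable_EFinP; exact: measurable_normal_pdf.
    by apply/measurable_EFinP; apply: measurable_funX; exact: measurable_funB.
  - apply/measurable_EFinP; apply: measurable_funM => //.
    exact: measurable_normal_pdf.
  - by move=> x _; rewrite lee_fin normal_pdf_fourth_le.
rewrite ge0_integralZl//.
- by rewrite integral_normal_pdf mule1.
- by apply/measurable_EFinP; exact: measurable_normal_pdf.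
- by move=> x _; rewrite lee_fin normal_pdf_ge0.
- by rewrite lee_fin mulr_ge0// exprn_even_ge0.
Qed.

Lemma normal_prob_ball m s : s != 0 ->
  (normal_prob m s `[(- (`|s| / 2))%R, (`|s| / 2)%R] <= (2^-1)%:E)%E.
Proof.
move=> s0; have ns : 0 < `|s| by rewrite normr_gt0.
rewrite /normal_prob.
apply: (@le_trans _ _ (\int[leb]_(x in `[(- (`|s| / 2))%R, (`|s| / 2)%R]) (normal_peak s)%:E)%E).
  apply: ge0_le_integral => //=.
  - by move=> x _; rewrite lee_fin normal_pdf_ge0.
  - by apply/measurable_EFinP; apply: measurable_funTS; exact: measurable_normal_pdf.
  - by move=> x _; rewrite lee_fin normal_pdf_ub.
rewrite integral_cst//= lebesgue_measure_itv/= lte_fin ifT; last first.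
  have : 0 < `|s| / 2 by rewrite divr_gt0. lra.
rewrite -EFinB opprK -splitr -EFinM lee_fin /normal_peak.
have : 2 * `|s| <= Num.sqrt (s ^+ 2 * pi *+ 2).
  rewrite -[leLHS]ger0_norm ?mulr_ge0// -sqrtr_sqr ler_wsqrtr//.
  rewrite exprMn real_normK ?num_real// -mulrnAr mulrC ler_wpM2l ?sqr_ge0//.
  by have := @pi_ge2 R; rewrite -mulr_natr; lra.
move=> h; rewrite mulrC ler_pdivrMr ?(lt_le_trans _ h) ?mulr_gt0//.
by lra.
Qed.


Context d (Omega : measurableType d) (P : probability Omega R).
Implicit Types (Y : Omega -> R).


Lemma ge0_integral_lin (g h : Omega -> R) (a b c : R) :
  measurable_fun setT g -> measurable_fun setT h ->
  (forall w, 0 <= g w) -> (forall w, 0 <= h w) -> 0 <= a -> 0 <= b -> 0 <= c ->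
  (\int[P]_w (a * g w + b * h w + c)%:E =
   a%:E * \int[P]_w (g w)%:E + b%:E * \int[P]_w (h w)%:E + c%:E)%E.
Proof.
move=> mg mh g0 h0 a0 b0 c0.
have mEg : measurable_fun setT (fun w => (g w)%:E) by exact/measurable_EFinP.
have mEh : measurable_fun setT (fun w => (h w)%:E) by exact/measurable_EFinP.
under eq_integral do rewrite !EFinD !EFinM.
rewrite ge0_integralD//; first last.
- by apply: emeasurable_funD; apply: emeasurable_funM.
- by move=> w _; rewrite -!EFinM -EFinD lee_fin addr_ge0 ?mulr_ge0.
rewrite ge0_integralD//; first last.
- by apply: emeasurable_funM.
- by move=> w _; rewrite -EFinM lee_fin mulr_ge0.
- by apply: emeasurable_funM.
- by move=> w _; rewrite -EFinM lee_fin mulr_ge0.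
rewrite !ge0_integralZl//; try by move=> w _; rewrite lee_fin.
by rewrite integral_cst//= probability_setT mule1.
Qed.

Lemma ge0_integral_normal_rv Y m s (g : R -> R) : measurable_fun setT Y ->
  normal_rv P Y m s -> measurable_fun setT g -> (forall x, 0 <= g x) ->
  (\int[P]_w (g (Y w))%:E =
   if s == 0%R then (g m)%:E else \int[normal_prob m s]_x (g x)%:E)%E.
Proof.
move=> mY nY mg g0.
have mp : measurable_fun setT (fun x : R => (g x)%:E) by exact/measurable_EFinP.
have p0 (x : R) : (0 <= (g x)%:E)%E by rewrite lee_fin.
case: ifPn => s0.
- have := @ge0_integral_pushforward _ _ _ _ R Y mY P setT _ measurableT mp (fun x _ => p0 x).
  rewrite preimage_setT => <-.
  rewrite (@eq_measure_integral _ _ _ _ \d_m)/=; last first.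
    by move=> A mA _; rewrite /pushforward nY// s0.
  by rewrite integral_dirac// diracT mul1e.
- have := @ge0_integral_pushforward _ _ _ (measurableTypeR R) R Y mY P setT _ measurableT mp
    (fun x _ => p0 x).
  rewrite preimage_setT => <-.
  apply: eq_measure_integral => A mA _.
  by rewrite /= /pushforward nY// (negbTE s0).
Qed.

Lemma measurable_funBX Y m k : measurable_fun setT Y ->
  measurable_fun setT (fun w => (Y w - m) ^+ k).
Proof. by move=> mY; apply: measurable_funX; exact: measurable_funB. Qed.

(** By [normal_prob_ball], [Y] exceeds [|s| / 2] in absolute value with
    probability at least one half, wherever its mean is. *)
Lemma normal_rv_second_moment_ge Y m s : measurable_fun setT Y ->
  normal_rv P Y m s -> s != 0 ->
  ((s ^+ 2 / 8)%:E <= \int[P]_w (Y w ^+ 2)%:E)%E.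
Proof.
move=> mY nY s0.
have s2 : 0 <= s ^+ 2 by rewrite sqr_ge0.
pose B := Y @^-1` `[(- (`|s| / 2))%R, (`|s| / 2)%R].
have mB : measurable B by rewrite -[B]setTI; apply: mY.
have PB : (P B <= (2^-1)%:E)%E.
  by rewrite nY// (negbTE s0); exact: normal_prob_ball.
have PCB : ((2^-1)%:E <= P (~` B))%E.
  have fB := fin_num_measure P _ mB.
  have {PB} : fine (P B) <= 2^-1 by rewrite -lee_fin fineK.
  by rewrite probability_setC// -(fineK fB) -EFinB lee_fin /=; lra.
apply: (@le_trans _ _ (\int[P]_w ((s ^+ 2 / 4) * \1_(~` B) w)%:E)%E).
  rewrite (_ : (fun w => _) = (fun w => (s ^+ 2 / 4)%:E * (\1_(~` B) w)%:E)%E); last first.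
    by apply/funext => w; rewrite EFinM.
  rewrite ge0_integralZl//; last 2 first.
  - by apply/measurable_EFinP; apply: measurable_indic; exact: measurableC.
  - by rewrite lee_fin divr_ge0.
  rewrite integral_indic//; last exact: measurableC.
  rewrite setIT (_ : s ^+ 2 / 8 = s ^+ 2 / 4 * 2^-1); last by field.
  by rewrite EFinM lee_wpmul2l// lee_fin divr_ge0.
apply: ge0_le_integral => //=.
- by move=> w _; rewrite lee_fin mulr_ge0// divr_ge0.
- apply/measurable_EFinP; apply: measurable_funM => //.
  by apply: measurable_indic; exact: measurableC.
- by apply/measurable_EFinP; exact: measurable_funX.
move=> w _; rewrite lee_fin indicE; case: (boolP (_ \in _)); last first.
  by move=> _; rewrite mulr0 sqr_ge0.
rewrite inE /B/= in_itv/= => /negP; rewrite -ler_norml -ltNge mulr1 => h.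
rewrite -[Y w ^+ 2]real_normK ?num_real// -[s ^+ 2]real_normK ?num_real//.
rewrite (_ : `|s| ^+ 2 / 4 = (`|s| / 2) ^+ 2); last by field.
by rewrite lerXn2r ?nnegrE// ?divr_ge0// ltW.
Qed.

(** Comparison of moments with a universal constant: both [s ^ 2] and [m ^ 2]
    are at most a multiple of [E Y^2], and [E Y^4] is at most a multiple of
    [s ^ 4 + m ^ 4]. *)
Lemma normal_rv_fourth_moment_le Y m s : measurable_fun setT Y ->
  normal_rv P Y m s ->
  (\int[P]_w (Y w ^+ 4)%:E
   <= (8 * (64 * 8 ^+ 2 + 1042 ^+ 2) * (fine (\int[P]_w (Y w ^+ 2)%:E)%E) ^+ 2)%:E)%E.
Proof.
move=> mY nY; have mX k : measurable_fun setT (fun x : R => x ^+ k).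
  exact: measurable_funX.
have [s0|s0] := eqVneq s 0.
  rewrite (@ge0_integral_normal_rv _ _ _ (fun x => x ^+ 4) mY nY) ?s0 ?eqxx//; last first.
    by move=> x; rewrite exprn_even_ge0.
  rewrite (@ge0_integral_normal_rv _ _ _ (fun x => x ^+ 2) mY nY) ?s0 ?eqxx//; last first.
    by move=> x; rewrite exprn_even_ge0.
  rewrite lee_fin /= -exprM.
  rewrite -[leLHS]mul1r ler_wpM2r ?exprn_even_ge0//.
  have : (0 : R) <= 1042 ^+ 2 by rewrite sqr_ge0.
  by move: (1042 ^+ 2) => ?; lra.
have s2 : 0 < s ^+ 2 by rewrite exprn_even_gt0.
have mYm4 := measurable_funBX m 4 mY.
have mY2 : measurable_fun setT (fun w => Y w ^+ 2) by exact: measurable_funX.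
have mY4 : measurable_fun setT (fun w => Y w ^+ 4) by exact: measurable_funX.
have p4 (x : R) : 0 <= x ^+ 4 by rewrite exprn_even_ge0.
have c4 : (\int[P]_w ((Y w - m) ^+ 4)%:E <= (64 * s ^+ 4)%:E)%E.
  rewrite (@ge0_integral_normal_rv _ _ _ (fun x => (x - m) ^+ 4) mY nY) ?(negbTE s0)//.
    exact: normal_prob_fourth_central.
  by apply: measurable_funX; exact: measurable_funB.
have c0 : (0 <= \int[P]_w ((Y w - m) ^+ 4)%:E)%E.
  by apply: integral_ge0 => w _; rewrite lee_fin.
have [q qE] : exists q : R, (\int[P]_w ((Y w - m) ^+ 4)%:E)%E = q%:E.
  exists (fine (\int[P]_w ((Y w - m) ^+ 4)%:E)%E); rewrite fineK// ge0_fin_numE//.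
  by rewrite (le_lt_trans c4)// ltry.
rewrite qE !lee_fin in c4 c0.
have sq_fourth x : x ^+ 2 <= s ^+ 2 + x ^+ 4 / s ^+ 2.
  rewrite -lerBlDl ler_pdivlMr//.
  have : (x ^+ 2 - s ^+ 2 / 2) ^+ 2 >= 0 by rewrite sqr_ge0.
  have : (s ^+ 2) ^+ 2 >= 0 by rewrite sqr_ge0.
  rewrite !expr2 !exprS expr0; lra.
have tau_fin : (\int[P]_w (Y w ^+ 2)%:E \is a fin_num)%E.
  rewrite ge0_fin_numE; last by apply: integral_ge0 => w _; rewrite lee_fin sqr_ge0.
  apply: (@le_lt_trans _ _ (\int[P]_w ((2 / s ^+ 2) * (Y w - m) ^+ 4 +
     0 * (Y w - m) ^+ 4 + (2 * m ^+ 2 + 2 * s ^+ 2))%:E)%E).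
    apply: ge0_le_integral => //=.
    - by move=> w _; rewrite lee_fin sqr_ge0.
    - exact/measurable_EFinP.
    - apply/measurable_EFinP; apply: measurable_funD => //; apply: measurable_funD;
        exact: measurable_funM.
    move=> w _; rewrite lee_fin mul0r addr0.
    have := sq_fourth (Y w - m).
    have := sqr_ge0 (Y w - 2 * m).
    rewrite (_ : 2 / s ^+ 2 * (Y w - m) ^+ 4 = 2 * ((Y w - m) ^+ 4 / s ^+ 2)); last by ring.
    by rewrite !expr2; lra.
  rewrite ge0_integral_lin//.
  - by rewrite qE -!EFinM -!EFinD ltry.
  - by rewrite divr_ge0// ltW.
  - by rewrite addr_ge0// mulr_ge0// sqr_ge0.
have := normal_rv_second_moment_ge mY nY s0.
rewrite -(fineK tau_fin) lee_fin; set tau := fine _ => s2tau.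
(* m^2 <= 2 Y^2 + 2 (Y - m)^2 and (Y - m)^2 <= s^2 + (Y - m)^4 / s^2, whose
   expectation is at most 65 s^2; and 2 + 2 * 65 * 8 = 1042. *)
have m2 : m ^+ 2 <= 1042 * tau.
  have : ((m ^+ 2)%:E <= \int[P]_w (2 * Y w ^+ 2 + (2 / s ^+ 2) * (Y w - m) ^+ 4 +
      2 * s ^+ 2)%:E)%E.
    have {1}-> : (m ^+ 2)%:E = (\int[P]_w (cst (m ^+ 2)%:E) w)%E.
      by rewrite integral_cst//= probability_setT mule1.
    apply: ge0_le_integral => //=.
    - by move=> w _; rewrite lee_fin sqr_ge0.
    - apply/measurable_EFinP; apply: measurable_funD => //; apply: measurable_funD;
        exact: measurable_funM.
    move=> w _; rewrite lee_fin.
    have := sq_fourth (Y w - m).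
    have := sqr_ge0 (2 * Y w - m).
    rewrite (_ : 2 / s ^+ 2 * (Y w - m) ^+ 4 = 2 * ((Y w - m) ^+ 4 / s ^+ 2)); last by ring.
    by rewrite !expr2; lra.
  rewrite ge0_integral_lin//.
  - rewrite qE -(fineK tau_fin) -/tau -!EFinM -!EFinD lee_fin.
    have : 2 / s ^+ 2 * q <= 128 * s ^+ 2.
      rewrite mulrAC ler_pdivrMr// -mulrA -exprD; lra.
    lra.
  - by move=> w; rewrite sqr_ge0.
  - by rewrite divr_ge0// ltW.
  - by rewrite mulr_ge0// ltW.
apply: (@le_trans _ _ (\int[P]_w (0 * Y w ^+ 2 + 8 * (Y w - m) ^+ 4 + 8 * m ^+ 4)%:E)%E).
  apply: ge0_le_integral => //=.
  - by move=> w _; rewrite lee_fin.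
  - exact/measurable_EFinP.
  - apply/measurable_EFinP; apply: measurable_funD => //; apply: measurable_funD;
      exact: measurable_funM.
  move=> w _; rewrite lee_fin mul0r add0r.
  set x := Y w - m; have -> : Y w = x + m by rewrite /x subrK.
  have h1 : (x + m) ^+ 2 <= 2 * x ^+ 2 + 2 * m ^+ 2.
    by have := sqr_ge0 (x - m); rewrite !expr2; lra.
  have h2 : ((x + m) ^+ 2) ^+ 2 <= (2 * x ^+ 2 + 2 * m ^+ 2) ^+ 2.
    by rewrite lerXn2r// nnegrE ?sqr_ge0// addr_ge0// mulr_ge0// sqr_ge0.
  have h3 := sqr_ge0 (x ^+ 2 - m ^+ 2).
  rewrite -exprM in h2; apply: (le_trans h2); move: h3.
  by rewrite (_ : 4%N = (2 * 2)%N)// !exprM; move: (x ^+ 2) (m ^+ 2) => X M; rewrite !expr2; lra.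
rewrite ge0_integral_lin//; [|by move=> w; rewrite sqr_ge0|by rewrite mulr_ge0].
rewrite qE -(fineK tau_fin) -/tau -!EFinM -!EFinD lee_fin mul0r add0r.
have tau0 : 0 <= tau by rewrite (le_trans _ s2tau)// divr_ge0// ltW.
have s4 : s ^+ 4 <= (8 * tau) ^+ 2.
  rewrite (_ : 4%N = (2 * 2)%N)// exprM lerXn2r ?nnegrE ?(ltW s2)// ?mulr_ge0//; lra.
have m4 : m ^+ 4 <= (1042 * tau) ^+ 2.
  have tau1042 : 0 <= 1042 * tau by rewrite mulr_ge0 ?ler0n.
  rewrite (_ : 4%N = (2 * 2)%N)// exprM.
  by apply: lerXn2r m2; rewrite nnegrE; [exact: sqr_ge0|exact: tau1042].
move: s4 m4; rewrite !exprMn.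
by move: (8 ^+ 2) (1042 ^+ 2) (tau ^+ 2) (s ^+ 4) (m ^+ 4) c4 => u v T S4 M4; lra.
Qed.

End GaussianMoments.

(** * Dyadic chaining for a process with bounded fourth moments of increments *)

Section Chaining.
Context {R : realType}.
Implicit Types (T M u c : R).

Definition grid T (n k : nat) : R := T * k%:R / 2 ^+ n.

Lemma gridS T n k : grid T n.+1 k.*2 = grid T n k.
Proof.
have p0 : (2 : R) ^+ n != 0 by rewrite expf_neq0.
by rewrite /grid -muln2 natrM exprS; field.
Qed.

Lemma grid_step T n k : grid T n k.+1 = grid T n k + T / 2 ^+ n.
Proof. by rewrite /grid -natr1; ring. Qed.

Lemma gridn T n : grid T n (2 ^ n) = T.
Proof. by rewrite /grid natrX mulfK// expf_neq0. Qed.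

Lemma grid_ge0 T n k : 0 <= T -> 0 <= grid T n k.
Proof. by move=> T0; rewrite divr_ge0// ?exprn_ge0// mulr_ge0. Qed.

Lemma grid_le T n k : 0 <= T -> (k <= 2 ^ n)%N -> grid T n k <= T.
Proof.
move=> T0 kn; rewrite -[leRHS](gridn T n) /grid ler_wpM2r ?invr_ge0 ?exprn_ge0//.
by rewrite ler_wpM2l// ler_nat.
Qed.

(** The dyadic point preceding [u] at level [n] is reached from [0] by at most
    one step of each level, so that geometrically small steps add up to a
    bounded displacement.  The point depends on [u] only, which is why the
    path [x] is quantified last. *)
Lemma dyadic_chaining T n u : 0 <= u -> u < T ->
  exists k, [/\ (k < 2 ^ n)%N, grid T n k <= u, u < grid T n k.+1 &
    forall (x : R -> R) M, 0 <= M ->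
      (forall m j, (j < 2 ^ m)%N ->
        `|x (grid T m j.+1) - x (grid T m j)| <= M * (8 / 9) ^+ m) ->
      `|x (grid T n k) - x 0| <= 9 * M * (1 - (8 / 9) ^+ n)].
Proof.
move=> u0 uT; elim: n => [|n [k [kn ku uk IH]]].
  exists 0%N; split => //.
  - by rewrite /grid mulr0 mul0r.
  - by rewrite /grid mulr1 expr0 divr1.
  - by move=> x M M0 _; rewrite /grid mulr0 mul0r subrr normr0 expr0 subrr mulr0.
have M9 M : 0 <= M -> 9 * M * (1 - (8 / 9) ^+ n.+1) =
    9 * M * (1 - (8 / 9) ^+ n) + M * (8 / 9) ^+ n.
  by move=> _; rewrite exprS; field.
have pw : (0 : R) <= (8 / 9) ^+ n by rewrite exprn_ge0.
have [mid|mid] := leP (grid T n.+1 k.*2.+1) u.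
- exists k.*2.+1; split => //.
  + by rewrite expnS mul2n ltn_Sdouble.
  + by rewrite (_ : k.*2.+2 = k.+1.*2)// gridS.
  + move=> x M M0 xM; rewrite M9//.
    rewrite (le_trans (ler_distD (x (grid T n k)) _ _))// addrC lerD ?IH//.
    rewrite -(gridS T n k) (le_trans (xM _ _ _))//.
      by rewrite expnS mul2n ltn_double.
    by rewrite ler_wpM2l// exprS ler_piMl//; lra.
- exists k.*2; split => //.
  + by rewrite expnS mul2n ltn_double.
  + by rewrite gridS.
  + move=> x M M0 xM; rewrite M9// gridS (le_trans (IH _ _ M0 xM))// lerDl.
    by rewrite mulr_ge0.
Qed.

Context d (Omega : measurableType d) (P : probability Omega R).

Lemma ge0_markov (g : Omega -> R) c : measurable_fun setT g ->
  (forall w, 0 <= g w) -> 0 < c ->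
  (P [set w | (c <= g w)%R] <= c^-1%:E * \int[P]_w (g w)%:E)%E.
Proof.
move=> mg g0 c0; have mEg : measurable_fun setT (EFin \o g) by exact/measurable_EFinP.
have := le_integral_abse P measurableT mEg c0.
rewrite setTI; under eq_integral do rewrite /= ger0_norm//.
rewrite (_ : [set x | _] = [set w | (c <= g w)%R]); last first.
  by apply/seteqP; split => w/=; rewrite ger0_norm// lee_fin.
by rewrite -lee_pdivlMl// muleC.
Qed.

Lemma tail_small (Y : Omega -> R) (kappa : R) : measurable_fun setT Y -> 0 < kappa ->
  exists n : nat, (P [set w | (n%:R <= `|Y w|)%R] <= kappa%:E)%E.
Proof.
move=> mY k0; pose F n := [set w | (n%:R <= `|Y w|)%R].
have mF n : measurable (F n).
  rewrite -[F n]setTI; apply: measurable_fun_le => //.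
  exact: measurableT_comp.
have : P (F n) @[n --> \oo] --> P (\bigcap_n F n).
  apply: nonincreasing_cvg_mu => //.
  - by rewrite ltey_eq fin_num_measure.
  - exact: bigcapT_measurable.
  - move=> m n mn; apply/subsetPset => w; apply: le_trans.
    by rewrite ler_nat.
rewrite (_ : \bigcap_n F n = set0) ?measure0; last first.
  apply/seteqP; split => // w /(_ (Num.bound `|Y w|) I); rewrite /F/= => h.
  by have := archi_boundP (normr_ge0 (Y w)); rewrite ltNge h.
move=> /fine_cvgP[_ /cvgr_lt /(_ kappa k0)[n _ nF]].
exists n; rewrite -(fineK (fin_num_measure P _ (mF n))) lee_fin ltW//.
by apply: nF => /=.
Qed.

Lemma le_geometric_eq0 (x : \bar R) c : (0 <= x)%E ->
  (forall n, x <= (c / 2 ^+ n)%:E)%E -> x = 0%E.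
Proof.
move=> x0 xc; apply/eqP; rewrite eq_le x0 andbT.
apply/lee_addgt0Pr => e e0; rewrite add0e.
pose n := Num.bound (`|c| / e).
apply: (le_trans (xc n)); rewrite lee_fin ler_pdivrMr ?exprn_gt0//.
have h : `|c| / e < n%:R by rewrite archi_boundP// divr_ge0// ltW.
rewrite ltr_pdivrMr// mulrC in h.
apply: (le_trans (ler_norm c)); apply: (le_trans (ltW h)).
rewrite ler_wpM2l ?(ltW e0)//.
by rewrite -natrX ler_nat ltnW// ltn_expl.
Qed.

Lemma geometric_nneseries_le (a rho : R) : 0 <= a -> 0 <= rho -> rho < 1 ->
  (\sum_(n <oo) (a * rho ^+ n)%:E <= (a / (1 - rho))%:E)%E.
Proof.
move=> a0 r0 r1; have r1' : 0 < 1 - rho by rewrite subr_gt0.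
apply: lime_le.
  by apply: is_cvg_nneseries => n _ _; rewrite lee_fin mulr_ge0// exprn_ge0.
apply: nearW => n; rewrite sumEFin lee_fin.
have -> : \sum_(0 <= i < n) a * rho ^+ i = a / (1 - rho) * (1 - rho ^+ n).
  elim: n => [|n IH]; first by rewrite big_nil expr0 subrr mulr0.
  by rewrite big_nat_recr//= IH exprS; field; rewrite gt_eqF.
by rewrite ler_piMr ?divr_ge0 ?gerBl ?exprn_ge0 ?(ltW r1').
Qed.

Variables (T K : R) (X : R -> Omega -> R).
Hypothesis T0 : 0 < T.
Hypothesis K0 : 0 <= K.
Hypothesis mX : forall u, measurable_fun setT (X u).
Hypothesis X4 : forall s t, 0 <= s <= T -> 0 <= t <= T ->
  (\int[P]_w ((X t w - X s w) ^+ 4)%:E <= (K * (t - s) ^+ 2)%:E)%E.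

Let inc n k w := X (grid T n k.+1) w - X (grid T n k) w.
Let lvl n w := \sum_(k < 2 ^ n) inc n k w ^+ 4.
(* The ratio 9/8 is greater than 1, so that the finiteness of the sum of the
   [wlvl n w] makes the increments of level n decay like (8/9)^n; its fourth
   power is less than 2, so that the expectation of this sum is finite. *)
Let wlvl n w := (9 / 8) ^+ (4 * n) * lvl n w.

Let pow4_ge0 (x : R) : 0 <= x ^+ 4. Proof. by rewrite exprn_even_ge0. Qed.

Let minc n k : measurable_fun setT (inc n k).
Proof. exact: measurable_funB. Qed.

Let mlvl n : measurable_fun setT (lvl n).
Proof.
by apply: measurable_sum => k; apply: measurable_funX; exact: minc.
Qed.

Let wlvl_ge0 n w : 0 <= wlvl n w.
Proof. by rewrite mulr_ge0 ?exprn_ge0//; apply: sumr_ge0. Qed.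

Let mwlvl n : measurable_fun setT (wlvl n).
Proof. exact: measurable_funM. Qed.

Let integral_lvl n :
  (\int[P]_w (lvl n w)%:E <= (K * T ^+ 2 / 2 ^+ n)%:E)%E.
Proof.
under eq_integral do rewrite /lvl -sumEFin.
rewrite ge0_integral_sum//; last 2 first.
- move=> k; apply/measurable_EFinP; apply: measurable_funX; exact: minc.
- by move=> k w _; rewrite lee_fin.
apply: (@le_trans _ _ (\sum_(k < 2 ^ n) (K * (T / 2 ^+ n) ^+ 2)%:E)%E).
  apply: lee_sum => k _; rewrite (le_trans (X4 _ _))//.
  - by rewrite grid_ge0 ?grid_le ?(ltW T0)// ltnW.
  - by rewrite grid_ge0 ?grid_le ?(ltW T0).
  - by rewrite lee_fin grid_step addrAC subrr add0r.
rewrite sumEFin sumr_const card_ord lee_fin -[leLHS]mulr_natr natrX.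
have p0 : (2 : R) ^+ n != 0 by rewrite expf_neq0.
by rewrite le_eqVlt; apply/orP; left; apply/eqP; field.
Qed.

Let rho : R := (9 / 8) ^+ 4 / 2.

Let integral_wlvl :
  (\int[P]_w (\sum_(n <oo) (wlvl n w)%:E) <= (K * T ^+ 2 / (1 - rho))%:E)%E.
Proof.
have KT : 0 <= K * T ^+ 2 by rewrite mulr_ge0// sqr_ge0.
rewrite integral_nneseries//; last 2 first.
- by move=> n; apply/measurable_EFinP; exact: mwlvl.
- by move=> n w _; rewrite lee_fin.
apply: le_trans (geometric_nneseries_le _ _ _) => //; last 2 first.
- by rewrite divr_ge0// exprn_ge0.
- by rewrite /rho !exprS expr0; lra.
apply: lee_nneseries => n _.
  by move=> _; apply: integral_ge0 => w _; rewrite lee_fin.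
rewrite /wlvl; under eq_integral do rewrite EFinM.
have c0 : 0 <= (9 / 8 : R) ^+ (4 * n) by rewrite exprn_ge0.
rewrite ge0_integralZl//; last 2 first.
- by apply/measurable_EFinP; exact: mlvl.
- by move=> w _; rewrite lee_fin sumr_ge0.
apply: (@le_trans _ _ (((9 / 8) ^+ (4 * n))%:E * (K * T ^+ 2 / 2 ^+ n)%:E)%E).
  by rewrite lee_wpmul2l.
rewrite -EFinM lee_fin exprM /rho; move: ((9 / 8 : R) ^+ 4) => q.
rewrite [(q / 2) ^+ n]exprMn exprVn.
by rewrite le_eqVlt; apply/orP; left; apply/eqP; ring.
Qed.

(** The event [A] says that the weighted sum of the fourth powers of all dyadic
    increments, and [X 0], are at most some constant [c >= 1].  On [A] the
    values of [X] along the dyadic chain leading to [u] stay below [10 * c],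
    and they converge in probability to [X u]. *)
Lemma path_bound (kappa : R) : 0 < kappa ->
  exists (A : set Omega) (M : R), [/\ measurable A, (P (~` A) <= kappa%:E)%E &
    forall u, 0 <= u < T -> P (A `&` [set w | (M <= `|X u w|)%R]) = 0%E].
Proof.
move=> k0; have k20 : 0 < kappa / 2 by rewrite divr_gt0.
have [n0 Pn0] := tail_small (mX 0) k20.
pose V := K * T ^+ 2 / (1 - rho).
have rho1 : 0 < 1 - rho by rewrite /rho !exprS expr0; lra.
have V0 : 0 <= V by rewrite divr_ge0 ?(ltW rho1)// mulr_ge0// sqr_ge0.
pose B w := (\sum_(n <oo) (wlvl n w)%:E)%E.
have mB : measurable_fun setT B.
  apply: ge0_emeasurable_sum => //.
  - by move=> n w _ _; rewrite lee_fin.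
  - by move=> n _; apply/measurable_EFinP; exact: mwlvl.
have B0 w : (0 <= B w)%E by apply: nneseries_ge0 => n _ _; rewrite lee_fin.
pose M := Num.max 1 (Num.max n0%:R (V / (kappa / 2))).
have M1 : 1 <= M by rewrite le_max lexx.
have M0 : 0 < M by rewrite (lt_le_trans _ M1).
have Mn : n0%:R <= M by rewrite !le_max lexx orbT.
have MV : V / (kappa / 2) <= M by rewrite !le_max lexx !orbT.
pose A1 := [set w | (M%:E <= B w)%E].
pose A2 := [set w | (M <= `|X 0 w|)%R].
have mA1 : measurable A1.
  by rewrite -[A1]setTI; apply: emeasurable_fun_c_infty.
have mA2 : measurable A2.
  rewrite -[A2]setTI; apply: measurable_fun_le => //.
  exact: measurableT_comp.
exists (~` (A1 `|` A2)), (10 * M + 1); split.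
- by apply: measurableC; exact: measurableU.
- rewrite setCK (le_trans (measureU2 _ _ _))//.
  rewrite [kappa]splitr EFinD leeD//.
    have := le_integral_abse P measurableT mB M0.
    rewrite setTI; under eq_integral do rewrite gee0_abs//.
    rewrite (_ : [set x | _] = A1); last first.
      by apply/seteqP; split => w/=; rewrite gee0_abs.
    move=> h; have := le_trans h integral_wlvl.
    rewrite -lee_pdivlMl// -EFinM => /le_trans; apply.
    rewrite lee_fin -/V mulrC ler_pdivrMr// mulrC -ler_pdivrMr//.
  rewrite (le_trans _ Pn0)//; apply: le_measure; rewrite ?inE//.
    rewrite -[X in measurable X]setTI; apply: measurable_fun_le => //.
    exact: measurableT_comp.
  by move=> w /=; apply: le_trans.
move=> u /andP[u0 uT].
apply: (@le_geometric_eq0 _ (K * T ^+ 2)); first exact: measure_ge0.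
move=> n; have [k [kn ku uk chain]] := dyadic_chaining n u0 uT.
have mXu : measurable [set w | 10 * M + 1 <= `|X u w|].
  rewrite -[X in measurable X]setTI; apply: measurable_fun_le => //.
  exact: measurableT_comp.
have mD : measurable_fun setT (fun w => (X u w - X (grid T n k) w) ^+ 4).
  by apply: measurable_funX; exact: measurable_funB.
apply: (@le_trans _ _ (P [set w | (1 <= (X u w - X (grid T n k) w) ^+ 4)%R])).
  apply: le_measure; rewrite ?inE//.
  - by apply: measurableI => //; apply: measurableC; exact: measurableU.
  - by rewrite -[X in measurable X]setTI; apply: measurable_fun_le.
  move=> w [/not_orP[/negP nA1 /negP nA2] /= Xu].
  rewrite -ltNge in nA1; rewrite -ltNge in nA2.
  have : `|X (grid T n k) w - X 0 w| <= 9 * M * (1 - (8 / 9) ^+ n).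
    apply: (chain (fun v => X v w) M (ltW M0)) => m j jm.
    have wM : wlvl m w <= M.
      rewrite -lee_fin (le_trans _ (ltW nA1))//.
      rewrite /B (@nneseriesD1 _ _ m)//; last by move=> j' _; rewrite lee_fin.
      by rewrite leeDl// nneseries_ge0// => j' _ _; rewrite lee_fin.
    have {wM} : ((9 / 8) ^+ m * `|inc m j w|) ^+ 4 <= M ^+ 4.
      apply: (@le_trans _ _ M); last by rewrite ler_eXnr.
      rewrite exprMn -exprM mulnC -normrX ger0_norm// (le_trans _ wM)//.
      rewrite /wlvl ler_wpM2l ?exprn_ge0//.
      by rewrite /lvl (bigD1 (Ordinal jm))//= lerDl sumr_ge0.
    rewrite ler_pXn2r ?nnegrE ?(ltW M0)// ?mulr_ge0 ?exprn_ge0//.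
    rewrite -ler_pdivlMl ?exprn_gt0// => /le_trans; apply.
    by rewrite mulrC -exprVn invf_div.
  have p8 : (0 : R) <= (8 / 9) ^+ n by rewrite exprn_ge0.
  have : 9 * M * (1 - (8 / 9) ^+ n) <= 9 * M.
    by rewrite ler_piMr ?gerBl// mulr_ge0// ltW.
  move=> h1 h2.
  have h3 : 1 <= `|X u w - X (grid T n k) w|.
    have t1 := ler_distD (X (grid T n k) w) (X u w) (X 0 w).
    have t2 := lerB_dist (X u w) (X 0 w).
    by move: nA2; rewrite /A2/=; lra.
  have -> : (X u w - X (grid T n k) w) ^+ 4 = `|X u w - X (grid T n k) w| ^+ 4.
    by rewrite -normrX ger0_norm.
  exact: exprn_ege1.
apply: (le_trans (ge0_markov mD _ _)) => //.
rewrite invr1 mul1e (le_trans (X4 _ _))//.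
- by rewrite grid_ge0 ?grid_le ?(ltW T0)// ltnW.
- by rewrite u0 ltW.
have du : 0 <= u - grid T n k by rewrite subr_ge0.
have du' : u - grid T n k <= T / 2 ^+ n.
  by rewrite lerBlDl -grid_step ltW.
rewrite lee_fin -mulrA ler_wpM2l//.
apply: (@le_trans _ _ ((T / 2 ^+ n) ^+ 2)).
  by rewrite lerXn2r// nnegrE (le_trans du).
rewrite expr_div_n ler_wpM2l ?sqr_ge0// lef_pV2 ?posrE ?exprn_gt0//.
by rewrite expr2 ler_peMl ?exprn_ge0// exprn_ege1// ler1n.
Qed.

End Chaining.

(** * The symmetric sum along one bounded path *)

Section Pathwise.
Context {R : realType}.
Local Notation leb := (@lebesgue_measure R).
Implicit Types (a b e t x u L H M : R) (f g y : R -> R).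

(** The paths integrated below are only measurable, so the translation of
    their integrals rests on the invariance of the measure. *)
Lemma lebesgue_measure_translation e (A : set R) : measurable A ->
  pushforward leb ((fun u => u + e) : _ -> measurableTypeR R) A = leb A.
Proof.
move=> mA; apply/esym/lebesgue_measure_unique => //=.
  exact: measurable_funD.
move=> mD _ [[a b]] _ <-.
rewrite /pushforward/= (_ : _ @^-1` _ = `]a - e, b - e]%classic).
  rewrite !lebesgue_measure_itv/= !lte_fin ltrD2r.
  by case: ifP => // _; congr (_%:E); ring.
by apply/seteqP; split => x /=; rewrite !in_itv/= ltrBlDr lerBrDr.
Qed.

Lemma Rintegral_translation g a b e : measurable_fun setT g ->
  \int[leb]_(u in `[a, b]) g (u + e) = \int[leb]_(u in `[a + e, b + e]) g u.
Proof.
move=> mg; rewrite /Rintegral; congr fine.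
have mphi : measurable_fun setT ((fun u => u + e) : R -> measurableTypeR R).
  exact: measurable_funD.
have ge0_translation (h : R -> \bar R) : measurable_fun setT h -> (forall x, 0 <= h x)%E ->
    (\int[leb]_(u in `[a, b]) h (u + e)%R = \int[leb]_(u in `[(a + e)%R, (b + e)%R]) h u)%E.
  move=> mh h0.
  rewrite (_ : `[a, b]%classic = (fun u => u + e) @^-1` `[a + e, b + e]); last first.
    by apply/seteqP; split => x /=; rewrite !in_itv/= !lerD2r.
  have := @ge0_integral_pushforward _ _ (measurableTypeR R) (measurableTypeR R) R _ mphi leb
     `[a + e, b + e]%classic h (measurable_itv _) (measurable_funS measurableT (@subsetT _ _) mh)
     (fun x _ => h0 x).
  move=> <-.
  by apply: eq_measure_integral => A mA _; exact: lebesgue_measure_translation.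
have mEg : measurable_fun setT (fun u => (g u)%:E) by exact/measurable_EFinP.
rewrite integralE [RHS]integralE; congr (_ - _)%E.
- rewrite -(ge0_translation _ (measurable_funepos mEg)); last exact: funepos_ge0.
  by apply: eq_integral => u _; rewrite !funeposE.
- rewrite -(ge0_translation _ (measurable_funeneg mEg)); last exact: funeneg_ge0.
  by apply: eq_integral => u _; rewrite !funenegE.
Qed.

Lemma integrable_itv_bounded g M a b : measurable_fun setT g ->
  (forall u, `|g u| <= M) -> leb.-integrable `[a, b] (EFin \o g).
Proof.
move=> mg gM; apply: measurable_bounded_integrable => //.
- by rewrite /= lebesgue_measure_itv/=; case: ifP => // _; rewrite -EFinB ltry.
- exact: measurable_funTS.
- exists M; split; first exact: num_real.
  by move=> N MN u _ /=; rewrite (le_trans (gM u))// ltW.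
Qed.

Lemma Rintegral_itv_cat g M a b c : measurable_fun setT g ->
  (forall u, `|g u| <= M) -> a <= b -> b <= c ->
  \int[leb]_(u in `[a, c]) g u =
  \int[leb]_(u in `[a, b]) g u + \int[leb]_(u in `[b, c]) g u.
Proof.
move=> mg gM ab bc.
have iab := integrable_itv_bounded a c mg gM.
have := Rintegral_itvB iab (x := b).
rewrite !bnd_simp => /(_ ab bc) E.
rewrite -[in X in _ + X]Rintegral_itv_obnd_cbnd; last first.
  by apply: integrableS iab => //; apply: subset_itvr; rewrite bnd_simp.
by rewrite -E; ring.
Qed.

Lemma average_dist g M e a : measurable_fun setT g -> (forall u, `|g u| <= M) ->
  0 < e ->
  `|e^-1 * \int[leb]_(u in `[a, a + e]) g u - g a|
  <= e^-1 * \int[leb]_(u in `[a, a + e]) `|g u - g a|.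
Proof.
move=> mg gM e0.
have ig := integrable_itv_bounded a (a + e) mg gM.
have ic : leb.-integrable `[a, (a + e)] (EFin \o cst (g a)).
  exact: (@integrable_itv_bounded _ `|g a|).
have -> : e^-1 * \int[leb]_(u in `[a, a + e]) g u - g a =
   e^-1 * \int[leb]_(u in `[a, a + e]) (g u - g a).
  rewrite (RintegralB _ ig ic)// Rintegral_cst//=.
  rewrite lebesgue_measure_itv/= lte_fin ltrDl e0/=.
  by rewrite addrAC subrr add0r; field; rewrite gt_eqF.
rewrite normrM (@ger0_norm _ e^-1) ?invr_ge0 ?(ltW e0)//.
rewrite ler_wpM2l ?invr_ge0 ?(ltW e0)// le_normr_Rintegral//.
exact: (integrableB _ ig ic).
Qed.

(** After the translation [u |-> u + e], the integrals of [f (y (u + e))] and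
    [f (y u)] from [0] to [t] differ by their parts near [t]
    and near [0]; what remains is the trapezoidal error. *)
Lemma stratonovich_pathwise f f1 f2 f3 y M H L t e :
  (forall x, is_derive x 1 f (f1 x)) ->
  (forall x, is_derive x 1 f1 (f2 x)) ->
  (forall x, is_derive x 1 f2 (f3 x)) ->
  (forall x, `|x| <= M -> `|f3 x| <= H) ->
  (forall x, `|x| <= M -> `|f1 x| <= L) ->
  measurable_fun setT y -> (forall u, `|y u| <= M) -> 0 <= t -> 0 < e ->
  `|e^-1 * \int[leb]_(u in `[0, t])
      ((y (u + e) - y u) * (2^-1 * (f1 (y (u + e)) + f1 (y u))))
    - (f (y t) - f (y 0))|
  <= e^-1 * (\int[leb]_(u in `[0, t]) (H * `|y (u + e) - y u| ^+ 3) +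
             (\int[leb]_(u in `[t, t + e]) (L * `|y u - y t|) +
              \int[leb]_(u in `[0, e]) (L * `|y u - y 0|))).
Proof.
move=> df df1 df2 f3H f1L my yM t0 e0.
have M0 : 0 <= M by rewrite (le_trans _ (yM 0)).
have H0 : 0 <= H by rewrite (le_trans _ (f3H (y 0) _)).
have cf := is_derive_continuous df; have cf1 := is_derive_continuous df1.
have mshift : measurable_fun setT (fun u => u + e) by exact: measurable_funD.
have mye : measurable_fun setT (fun u => y (u + e)) by exact: measurableT_comp.
pose F u := f (y u).
have mF : measurable_fun setT F.
  by apply: measurableT_comp => //; exact: continuous_measurable_fun.
have [B fB] := continuous_norm_ub M cf.
have FB u : `|F u| <= B by exact: fB.
have mFe : measurable_fun setT (fun u => F (u + e)) by exact: measurableT_comp.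
pose S u := (y (u + e) - y u) * (2^-1 * (f1 (y (u + e)) + f1 (y u))).
have mf1 : measurable_fun setT f1 by exact: continuous_measurable_fun.
have mS : measurable_fun setT S.
  apply: measurable_funM; first exact: measurable_funB.
  apply: measurable_funM => //.
  by apply: measurable_funD; exact: measurableT_comp.
have yy3 u v : `|y u - y v| <= 2 * M.
  by rewrite (le_trans (ler_normB _ _))// mulr_natl mulr2n lerD.
pose D u := F (u + e) - F u - S u.
have DH u : `|D u| <= H * `|y (u + e) - y u| ^+ 3.
  exact: (trapezoid_error df df1 df2 f3H).
have mD : measurable_fun setT D.
  by apply: measurable_funB => //; exact: measurable_funB.
have DHM u : `|D u| <= H * (2 * M) ^+ 3.
  rewrite (le_trans (DH u))// ler_wpM2l// lerXn2r ?nnegrE//.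
  by rewrite mulr_ge0.
have DFB u : `|F (u + e) - F u| <= 2 * B.
  by rewrite (le_trans (ler_normB _ _))// mulr_natl mulr2n lerD.
have iD := integrable_itv_bounded 0 t mD DHM.
have iF := integrable_itv_bounded 0 t mF FB.
have iFe := integrable_itv_bounded 0 t mFe (fun u => FB (u + e)).
have mDF : measurable_fun setT (fun u => F (u + e) - F u) by exact: measurable_funB.
have iDF := integrable_itv_bounded 0 t mDF DFB.
have te : t <= t + e by rewrite lerDl ltW.
have ete : e <= t + e by rewrite lerDr.
have SE : \int[leb]_(u in `[0, t]) S u =
    \int[leb]_(u in `[t, t + e]) F u - \int[leb]_(u in `[0, e]) F u
    - \int[leb]_(u in `[0, t]) D u.
  transitivity (\int[leb]_(u in `[0, t]) (F (u + e) - F u - D u)).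
    by apply: eq_Rintegral => u _; rewrite /D; ring.
  rewrite (RintegralB _ iDF iD)// (RintegralB _ iFe iF)//.
  rewrite (@Rintegral_translation F)// add0r.
  have c1 := Rintegral_itv_cat mF FB t0 te.
  have c2 := Rintegral_itv_cat mF FB (ltW e0) ete.
  by move: c1 c2; lra.
have lipF u v : `|F u - F v| <= L * `|y u - y v|.
  apply: (mean_value_ineq df) => x xuv; apply: f1L.
  exact: norm_le_segment xuv.
have L0 : 0 <= L by rewrite (le_trans _ (f1L (y 0) _)).
have int_dist a b v : \int[leb]_(u in `[a, b]) `|F u - F v| <=
    \int[leb]_(u in `[a, b]) (L * `|y u - y v|).
  apply: le_Rintegral => //.
  - apply: (@integrable_itv_bounded _ (2 * B)).
      by apply: measurableT_comp => //; exact: measurable_funB.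
    by move=> u; rewrite normr_id (le_trans (ler_normB _ _))// mulr_natl mulr2n lerD.
  - apply: (@integrable_itv_bounded _ (L * (2 * M))).
      apply: measurable_funM => //.
      by apply: measurableT_comp => //; exact: measurable_funB.
    by move=> u; rewrite normrM normr_id ger0_norm// ler_wpM2l.
have avt := average_dist t mF FB e0.
have av0 := average_dist 0 mF FB e0.
rewrite add0r in av0.
have intD : `|\int[leb]_(u in `[0, t]) D u| <=
    \int[leb]_(u in `[0, t]) (H * `|y (u + e) - y u| ^+ 3).
  apply: (le_trans (le_normr_Rintegral _ iD)) => //.
  apply: le_Rintegral => //.
  - apply: (@integrable_itv_bounded _ (H * (2 * M) ^+ 3)).
      exact: measurableT_comp.
    by move=> u; rewrite normr_id.
  - apply: (@integrable_itv_bounded _ (H * (2 * M) ^+ 3)).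
      apply: measurable_funM => //; apply: measurable_funX.
      by apply: measurableT_comp => //; exact: measurable_funB.
    move=> u; rewrite normrM (ger0_norm H0) ler_wpM2l// normrX normr_id.
    by rewrite lerXn2r ?nnegrE// mulr_ge0.
have ei : 0 <= e^-1 by rewrite invr_ge0 ltW.
rewrite SE.
set I1 := \int[leb]_(u in `[t, t + e]) F u in avt *.
set I2 := \int[leb]_(u in `[0, e]) F u in av0 *.
set I3 := \int[leb]_(u in `[0, t]) D u in intD *.
rewrite (_ : e^-1 * (I1 - I2 - I3) - _ =
  (e^-1 * I1 - F t) - (e^-1 * I2 - F 0) - e^-1 * I3); last by rewrite /F; ring.
apply: (le_trans (ler_normB _ _)); rewrite mulrDr addrC lerD//.
  by rewrite normrM (ger0_norm ei) ler_wpM2l.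
apply: (le_trans (ler_normB _ _)); rewrite mulrDr lerD//.
  by apply: (le_trans avt); rewrite ler_wpM2l.
by apply: (le_trans av0); rewrite ler_wpM2l.
Qed.

End Pathwise.

(** * The symmetric sum of a bounded process *)

Section Parametric.
Context {R : realType} d (Omega : measurableType d) (P : probability Omega R).
Local Notation leb := (@lebesgue_measure R).
Implicit Types (a b c : R) (D : set R).

Lemma integral_indicM (h : R -> R) D :
  (\int[leb]_(u in D) (h u)%:E = \int[leb]_u (h u * \1_D u)%:E)%E.
Proof.
rewrite integral_mkcond; apply: eq_integral => u _.
by rewrite patchE indicE; case: ifP; rewrite ?mulr1 ?mulr0.
Qed.

Lemma measurable_indicM (h : R * Omega -> R) D : measurable D ->
  measurable_fun setT h ->
  measurable_fun setT (fun p : R * Omega => (h p * \1_D p.1)%:E).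
Proof.
move=> mD mh; apply/measurable_EFinP; apply: measurable_funM => //.
by apply: measurableT_comp => //; exact: measurable_indic.
Qed.

Lemma ge0_measurable_integral (h : R * Omega -> R) D : measurable D ->
  measurable_fun setT h -> (forall p, 0 <= h p) ->
  measurable_fun setT (fun w => \int[leb]_(u in D) (h (u, w))%:E)%E.
Proof.
move=> mD mh h0.
under eq_fun do rewrite integral_indicM.
apply: (@measurable_fun_fubini_tonelli_G _ _ (measurableTypeR R) Omega R leb
  (fun p => (h p * \1_D p.1)%:E)).
  exact: measurable_indicM.
by move=> p; rewrite lee_fin mulr_ge0.
Qed.

Lemma measurable_Rintegral (h : R * Omega -> R) D : measurable D ->
  measurable_fun setT h ->
  measurable_fun setT (fun w => \int[leb]_(u in D) h (u, w)).
Proof.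
move=> mD mh.
suff mI : measurable_fun setT (fun w => \int[leb]_(u in D) (h (u, w))%:E)%E.
  by apply: (measurableT_comp _ mI).
under eq_fun do rewrite integralE.
apply: emeasurable_funB.
- have := @ge0_measurable_integral (fun p => Num.max (h p) 0) D mD.
  rewrite (_ : (fun w => _) = (fun w => \int[leb]_(u in D)
     ((fun x => (h (x, w))%:E)^\+ u))%E) => [|].
    apply; first exact: measurable_maxr.
    by move=> p; rewrite le_max lexx orbT.
  apply/funext => w; apply: eq_integral => u _.
  by rewrite funeposE EFin_max.
- have := @ge0_measurable_integral (fun p => Num.max (- h p) 0) D mD.
  rewrite (_ : (fun w => _) = (fun w => \int[leb]_(u in D)
     ((fun x => (h (x, w))%:E)^\- u))%E) => [|].
    apply; first by apply: measurable_maxr => //; exact: measurableT_comp.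
    by move=> p; rewrite le_max lexx orbT.
  apply/funext => w; apply: eq_integral => u _.
  by rewrite funenegE EFin_max.
Qed.

(** Tonelli's theorem, in the form in which it turns estimates at each fixed
    time into an estimate of the expectation of a time integral. *)
Lemma integral_section_le (g : R * Omega -> R) a b c : a <= b -> 0 <= c ->
  measurable_fun setT g -> (forall p, 0 <= g p) ->
  (forall u, (a <= u <= b)%R -> \int[P]_w (g (u, w))%:E <= c%:E)%E ->
  (\int[P]_w \int[leb]_(u in `[a, b]) (g (u, w))%:E <= (c * (b - a))%:E)%E.
Proof.
move=> ab c0 mg g0 gc.
under eq_integral do rewrite integral_indicM.
have := @fubini_tonelli _ _ (measurableTypeR R) Omega R leb P
  (fun p => (g p * \1_`[a, b] p.1)%:E).
move=> <-; last 2 first.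
- exact: measurable_indicM.
- by move=> p; rewrite lee_fin mulr_ge0.
have mgu u : measurable_fun setT (fun w => g (u, w)).
  by apply: measurableT_comp => //; exact: pair1_measurable.
apply: (@le_trans _ _ (\int[leb]_u (c * \1_`[a, b] u)%:E)%E).
  apply: ge0_le_integral => //=.
  - by move=> u _; apply: integral_ge0 => w _; rewrite lee_fin mulr_ge0.
  - apply: (@measurable_fun_fubini_tonelli_F _ _ (measurableTypeR R) Omega R P
      (fun p => (g p * \1_`[a, b] p.1)%:E)).
      exact: measurable_indicM.
    by move=> p; rewrite lee_fin mulr_ge0.
  - by apply/measurable_EFinP; apply: measurable_funM => //; exact: measurable_indic.
  move=> u _.
  have [uab|uab] := boolP (u \in `[a, b]%classic).
    rewrite indicE uab mulr1; under eq_integral do rewrite mulr1.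
    by apply: gc; move: uab; rewrite inE/= in_itv.
  rewrite indicE (negbTE uab) mulr0; under eq_integral do rewrite mulr0.
  by rewrite integral0.
rewrite -integral_indicM integral_cst//= lebesgue_measure_itv/= lte_fin.
case: ifP => [_|]; first by rewrite -EFinB -EFinM.
by rewrite mule0 lee_fin mulr_ge0// subr_ge0.
Qed.

Lemma ge0_integralZD3 (k : \bar R) (j1 j2 j3 : Omega -> \bar R) :
  measurable_fun setT j1 -> measurable_fun setT j2 -> measurable_fun setT j3 ->
  (forall w, 0 <= j1 w)%E -> (forall w, 0 <= j2 w)%E -> (forall w, 0 <= j3 w)%E ->
  (0 <= k)%E ->
  (\int[P]_w (k * (j1 w + (j2 w + j3 w))) =
   k * (\int[P]_w j1 w + (\int[P]_w j2 w + \int[P]_w j3 w)))%E.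
Proof.
move=> m1 m2 m3 p1 p2 p3 k0.
have m23 : measurable_fun setT (fun w => j2 w + j3 w)%E by exact: emeasurable_funD.
have p23 w : (0 <= j2 w + j3 w)%E by rewrite adde_ge0.
rewrite ge0_integralZl//.
- by rewrite ge0_integralD// ge0_integralD.
- exact: emeasurable_funD.
- by move=> w _; rewrite adde_ge0.
Qed.

Lemma EFin_fine_le (x : \bar R) : (0 <= x)%E -> ((fine x)%:E <= x)%E.
Proof. by case: x => //= x0; exact: leey. Qed.

End Parametric.

Section SymmetricSums.
Context {R : realType} d (Omega : measurableType d) (P : probability Omega R).
Local Notation leb := (@lebesgue_measure R).
Implicit Types (X : R -> Omega -> R) (a b c t e x M H L K T : R) (f g : R -> R).

(** [symmetric_sum] for a family of plain functions, so that it applies to a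
    truncated process. *)
Definition sym_sum X (g : R -> R) t e w : R :=
  e^-1 * \int[leb]_(u in `[0, t])
    ((X (u + e) w - X u w) * (2^-1 * (g (X (u + e) w) + g (X u w)))).

Definition joint_measurable X :=
  measurable_fun setT (fun p : R * Omega => X p.1 p.2).

Definition fourth_moment_bound T K X := forall s t, 0 <= s <= T -> 0 <= t <= T ->
  (\int[P]_w ((X t w - X s w) ^+ 4)%:E <= (K * (t - s) ^+ 2)%:E)%E.

Section Measurability.
Variables (X : R -> Omega -> R) (mX : joint_measurable X).

Lemma joint_measurable_l u : measurable_fun setT (X u).
Proof. exact: (measurableT_comp mX (pair1_measurable u)). Qed.

Lemma joint_measurable_r w : measurable_fun setT (fun u => X u w).
Proof. exact: (measurableT_comp mX (pair2_measurable w)). Qed.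

Lemma joint_measurable_shift e : joint_measurable (fun u => X (u + e)).
Proof.
have mshift : measurable_fun setT (fun p : R * Omega => (p.1 + e, p.2)).
  apply/measurable_fun_pairP; split; last exact: measurable_snd.
  by apply: measurable_funD => //; exact: measurable_fst.
exact: (measurableT_comp mX mshift).
Qed.

Lemma measurable_sym_integrand (g : R -> R) e : measurable_fun setT g ->
  measurable_fun setT (fun p : R * Omega =>
    (X (p.1 + e) p.2 - X p.1 p.2) * (2^-1 * (g (X (p.1 + e) p.2) + g (X p.1 p.2)))).
Proof.
move=> mg; have mXe := joint_measurable_shift e.
apply: measurable_funM; first exact: measurable_funB.
apply: measurable_funM => //.
by apply: measurable_funD; exact: measurableT_comp.
Qed.

Lemma measurable_sym_sum (g : R -> R) t e : measurable_fun setT g ->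
  measurable_fun setT (sym_sum X g t e).
Proof.
move=> mg; apply: measurable_funM => //.
exact: (measurable_Rintegral (measurable_itv _) (measurable_sym_integrand e mg)).
Qed.

End Measurability.

(** The expectations of the three time integrals of [stratonovich_pathwise]
    are of order [e * sqrt e]: an increment over a time at most [e] has size
    [sqrt e]. *)
Lemma sym_sum_bounded_L1 X T K (f f1 f2 f3 : R -> R) M H L t e :
  joint_measurable X -> fourth_moment_bound T K X -> 0 <= K ->
  (forall u w, `|X u w| <= M) ->
  (forall x, is_derive x 1 f (f1 x)) ->
  (forall x, is_derive x 1 f1 (f2 x)) ->
  (forall x, is_derive x 1 f2 (f3 x)) ->
  0 <= H -> 0 <= L ->
  (forall x, `|x| <= M -> `|f3 x| <= H) ->
  (forall x, `|x| <= M -> `|f1 x| <= L) ->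
  0 <= t -> 0 < e -> t + e <= T ->
  (\int[P]_w (`|sym_sum X f1 t e w - (f (X t w) - f (X 0 w))|)%:E
   <= ((1 + K) * (H * t + 2 * L) * Num.sqrt e)%:E)%E.
Proof.
move=> mX X4 K0 XM df df1 df2 H0 L0 f3H f1L t0 e0 teT.
have cf := is_derive_continuous df; have cf1 := is_derive_continuous df1.
have mf : measurable_fun setT f by exact: continuous_measurable_fun.
have mf1 : measurable_fun setT f1 by exact: continuous_measurable_fun.
have mXe := joint_measurable_shift mX e.
have mXu := joint_measurable_l mX.
have ei : 0 < e^-1 by rewrite invr_gt0.
set s := Num.sqrt e; have s0 : 0 < s by rewrite sqrtr_gt0.
have s0' := ltW s0; have K1 : 0 <= 1 + K by rewrite addr_ge0.
have s2 : s ^+ 2 = e by rewrite sqr_sqrtr// ltW.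
have pow4_ge0 (x : R) : 0 <= x ^+ 4 by rewrite exprn_even_ge0.
have e_le_T : e <= T by rewrite (le_trans _ teT)// lerDr.
have T0 : 0 <= T by rewrite (le_trans _ e_le_T)// ltW.
pose g1 (p : R * Omega) := H * `|X (p.1 + e) p.2 - X p.1 p.2| ^+ 3.
pose g2 v (p : R * Omega) := L * `|X p.1 p.2 - X v p.2|.
have mg1 : measurable_fun setT g1.
  apply: measurable_funM => //; apply: measurable_funX.
  by apply: measurableT_comp => //; exact: measurable_funB.
have mg2 v : measurable_fun setT (g2 v).
  apply: measurable_funM => //; apply: measurableT_comp => //.
  by apply: measurable_funB => //; apply: measurableT_comp => //; exact: measurable_snd.
have g10 p : 0 <= g1 p by rewrite mulr_ge0// exprn_ge0.
have g20 v p : 0 <= g2 v p by rewrite mulr_ge0.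
pose J1 w := (\int[leb]_(u in `[0%R, t]) (g1 (u, w))%:E)%E.
pose J2 v a w := (\int[leb]_(u in `[v, a]) (g2 v (u, w))%:E)%E.
have J10 w : (0 <= J1 w)%E by apply: integral_ge0 => u _; rewrite lee_fin.
have J20 v a w : (0 <= J2 v a w)%E by apply: integral_ge0 => u _; rewrite lee_fin.
have mJ1 : measurable_fun setT J1 by exact: ge0_measurable_integral.
have mJ2 v a : measurable_fun setT (J2 v a) by exact: ge0_measurable_integral.
have increment4 v : 0 <= v -> v + e <= T -> forall u, v <= u <= v + e ->
    (\int[P]_w ((X u w - X v w) ^+ 4)%:E <= (K * e ^+ 2)%:E)%E.
  move=> v0 veT u /andP[vu uve]; rewrite (le_trans (X4 _ _ _ _))//.
  - by rewrite v0 (le_trans _ veT)// lerDl ltW.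
  - by rewrite (le_trans v0 vu) (le_trans uve).
  - rewrite lee_fin ler_wpM2l// lerXn2r ?nnegrE ?subr_ge0// ?(ltW e0)//.
    by rewrite lerBlDl.
have moment (h : Omega -> R) c : measurable_fun setT h ->
    (\int[P]_w (h w ^+ 4)%:E <= (K * e ^+ 2)%:E)%E -> 0 <= c ->
    (\int[P]_w (c * `|h w| ^+ 3)%:E <= (c * ((1 + K) * s ^+ 3))%:E)%E /\
    (\int[P]_w (c * `|h w|)%:E <= (c * ((1 + K) * s))%:E)%E.
  move=> mh h4 c0.
  have mh4 : measurable_fun setT (fun w => h w ^+ 4) by exact: measurable_funX.
  have h40 : (0 <= \int[P]_w (h w ^+ 4)%:E)%E.
    by apply: integral_ge0 => w _; rewrite lee_fin.
  have affine (q r : R) (F : Omega -> R) : 0 <= q -> 0 <= r ->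
      measurable_fun setT F -> (forall w, 0 <= F w) ->
      (forall w, F w <= q + h w ^+ 4 / r) ->
      (\int[P]_w (c * F w)%:E <= (c * (q + K * e ^+ 2 / r))%:E)%E.
    move=> q0 r0 mF F0 Fqr.
    apply: (@le_trans _ _ (\int[P]_w (0 * h w ^+ 4 + (c / r) * h w ^+ 4 + c * q)%:E)%E).
      apply: ge0_le_integral => //=.
      - by move=> w _; rewrite lee_fin mulr_ge0.
      - by apply/measurable_EFinP; exact: measurable_funM.
      - apply/measurable_EFinP; apply: measurable_funD => //.
        by apply: measurable_funD; exact: measurable_funM.
      - move=> w _; rewrite lee_fin mul0r add0r.
        rewrite (_ : _ + _ = c * (q + h w ^+ 4 / r)); last by ring.
        exact: ler_wpM2l.
    rewrite ge0_integral_lin ?mulr_ge0 ?invr_ge0//.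
    rewrite mul0e add0e (_ : c * (q + _) = (c / r) * (K * e ^+ 2) + c * q); last by ring.
    by rewrite EFinD leeD2r// [leRHS]EFinM lee_wpmul2l// lee_fin divr_ge0.
  split.
  - have := @affine (s ^+ 3) s (fun w => `|h w| ^+ 3).
    rewrite (_ : s ^+ 3 + K * e ^+ 2 / s = (1 + K) * s ^+ 3); last first.
      by rewrite -s2; field; rewrite gt_eqF.
    apply; rewrite ?exprn_ge0 ?ltW//.
    + by apply: measurable_funX; exact: measurableT_comp.
    + by move=> w; exact: cube_le.
  - have := @affine s (s ^+ 3) (fun w => `|h w|).
    rewrite (_ : s + K * e ^+ 2 / s ^+ 3 = (1 + K) * s); last first.
      by rewrite -s2; field; rewrite gt_eqF.
    apply; rewrite ?exprn_ge0 ?ltW//.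
    + exact: measurableT_comp.
    + by move=> w; exact: norm_le_fourth.
have EJ1 : (\int[P]_w J1 w <= (H * ((1 + K) * s ^+ 3) * (t - 0))%:E)%E.
  apply: integral_section_le => //.
    by rewrite !mulr_ge0 ?exprn_ge0.
  move=> u /andP[u0 ut].
  apply: (proj1 (@moment (fun w => X (u + e) w - X u w) H _ _ _)) => //.
    exact: measurable_funB.
  apply: (@increment4 u) => //.
  + by rewrite (le_trans _ teT)// lerD2r.
  + by rewrite lerDl ltW//=.
have EJ2 v : 0 <= v -> v + e <= T ->
    (\int[P]_w J2 v (v + e)%R w <= (L * ((1 + K) * s) * e)%:E)%E.
  move=> v0 veT; rewrite [X in L * _ * X](_ : e = v + e - v); last by ring.
  apply: integral_section_le => //.
  - by rewrite lerDl ltW.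
  - by rewrite !mulr_ge0.
  move=> u uve.
  apply: (proj2 (@moment (fun w => X u w - X v w) L _ _ _)) => //.
    exact: measurable_funB.
  exact: increment4.
apply: (@le_trans _ _ (\int[P]_w ((e^-1)%:E *
    (J1 w + (J2 t (t + e)%R w + J2 0%R (0 + e)%R w))))%E).
  apply: ge0_le_integral => //=.
  - apply/measurable_EFinP; apply: measurableT_comp => //.
    apply: measurable_funB; first exact: measurable_sym_sum.
    by apply: measurable_funB; exact: measurableT_comp.
  - apply: emeasurable_funM => //; apply: emeasurable_funD => //.
    exact: emeasurable_funD.
  move=> w _.
  have mXw := joint_measurable_r mX w.
  have := stratonovich_pathwise df df1 df2 f3H f1L mXw (fun u => XM u w) t0 e0.
  rewrite -/(sym_sum X f1 t e w) -lee_fin => /le_trans; apply.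
  rewrite EFinM lee_wpmul2l// ?lee_fin ?(ltW ei)//.
  rewrite add0r !EFinD leeD ?leeD//.
  - exact: (EFin_fine_le (J10 w)).
  - exact: (EFin_fine_le (J20 t (t + e) w)).
  - exact: (EFin_fine_le (J20 0 e w)).
rewrite ge0_integralZD3//; last by rewrite lee_fin ltW.
apply: (@le_trans _ _ ((e^-1)%:E * ((H * ((1 + K) * s ^+ 3) * (t - 0))%:E +
   ((L * ((1 + K) * s) * e)%:E + (L * ((1 + K) * s) * e)%:E)))%E).
  apply: lee_wpmul2l; first by rewrite lee_fin ltW.
  apply: leeD; first exact: EJ1.
  by apply: leeD; apply: EJ2; rewrite ?add0r.
rewrite -!EFinD -EFinM lee_fin le_eqVlt; apply/orP; left; apply/eqP.
by rewrite -s2; field; rewrite gt_eqF.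
Qed.

End SymmetricSums.

(** * Truncation and convergence in probability *)

Section Localization.
Context {R : realType}.
Local Notation leb := (@lebesgue_measure R).
Implicit Types (x y M : R).

Definition clip M x : R := Num.max (- M) (Num.min M x).

Lemma clip_bounded M x : 0 <= M -> `|clip M x| <= M.
Proof.
move=> M0; rewrite /clip ler_norml le_max lexx/= ge_max ge_min lexx/= andbT.
by rewrite ge0_cp.
Qed.

Lemma clip_id M x : `|x| <= M -> clip M x = x.
Proof. by rewrite /clip ler_norml => /andP[h1 h2]; rewrite min_r// max_r. Qed.

Lemma clip_lipschitz M x y : `|clip M x - clip M y| <= `|x - y|.
Proof.
rewrite /clip ler_norml.
have := ler_norm (x - y); have := ler_norm (- (x - y)); rewrite normrN.
by have [h1|h1] := leP M x; have [h2|h2] := leP M y; have [h3|h3] := leP (- M) M;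
  have [h4|h4] := leP (- M) x; have [h5|h5] := leP (- M) y => h6 h7;
  apply/andP; split; lra.
Qed.

Lemma measurable_clip M : measurable_fun setT (clip M).
Proof. by apply: measurable_maxr => //; exact: measurable_minr. Qed.

Context d (Omega : measurableType d) (P : probability Omega R).
Implicit Types (X : R -> Omega -> R) (K T t e : R) (f g : R -> R).

Lemma joint_measurable_clip M X : joint_measurable X ->
  joint_measurable (fun u w => clip M (X u w)).
Proof. by move=> mX; exact: (measurableT_comp (measurable_clip M) mX). Qed.

(** Truncation is 1-Lipschitz, so it does not increase the increments. *)
Lemma fourth_moment_bound_clip M T K X : joint_measurable X ->
  fourth_moment_bound P T K X ->
  fourth_moment_bound P T K (fun u w => clip M (X u w)).
Proof.
move=> mX X4 s t sT tT; have mXu := joint_measurable_l mX.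
have mcX u := joint_measurable_l (joint_measurable_clip M mX) u.
apply: le_trans (X4 s t sT tT); apply: ge0_le_integral => //=.
- by move=> w _; rewrite lee_fin exprn_even_ge0.
- by apply/measurable_EFinP; apply: measurable_funX; exact: measurable_funB.
- by apply/measurable_EFinP; apply: measurable_funX; exact: measurable_funB.
move=> w _; rewrite lee_fin.
have p4 (x : R) : x ^+ 4 = `|x| ^+ 4 by rewrite -normrX ger0_norm// exprn_even_ge0.
by rewrite p4 [leRHS]p4 lerXn2r ?nnegrE// clip_lipschitz.
Qed.

(** Each [u] has its own null event on which [X u] exceeds [M] within [A]; by
    Tonelli, almost every path in [A] is bounded by [M] at almost every time,
    both at [u] and at [u + e], and the two integrals agree. *)
Lemma sym_sum_clip X (A : set Omega) T M (f g : R -> R) t e : joint_measurable X -> measurable A ->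
  measurable_fun setT g -> 0 <= M ->
  (forall u, 0 <= u < T -> P (A `&` [set w | (M <= `|X u w|)%R]) = 0%E) ->
  0 <= t -> 0 < e -> t + e < T ->
  {ae P, forall w, A w ->
    sym_sum X g t e w - (f (X t w) - f (X 0 w)) =
    sym_sum (fun u w => clip M (X u w)) g t e w -
      (f (clip M (X t w)) - f (clip M (X 0 w)))}.
Proof.
move=> mX mA mg M0 AM t0 e0 teT.
have tT : t < T by rewrite (le_lt_trans _ teT)// lerDl ltW.
have mXu := joint_measurable_l mX.
have mXe := joint_measurable_shift mX e.
have null_at u : 0 <= u < T -> {ae P, forall w, A w -> `|X u w| <= M}.
  move=> uT; exists (A `&` [set w | (M <= `|X u w|)%R]); split; first 1 last.
  - exact: AM.
  - by move=> w /= /not_implyP[Aw /negP]; rewrite -ltNge => /ltW.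
  apply: measurableI => //; rewrite -[X in measurable X]setTI.
  by apply: measurable_fun_le => //; exact: measurableT_comp.
pose B (Y : R -> Omega -> R) := [set p : R * Omega | A p.2 /\ M <= `|Y p.1 p.2|].
have mB Y : joint_measurable Y -> measurable (B Y).
  move=> mY; rewrite (_ : B Y = (snd @^-1` A) `&` [set p | M <= `|Y p.1 p.2|])//.
  apply: measurableI.
    by rewrite -[X in measurable X]setTI; exact: measurable_snd.
  rewrite -[X in measurable X]setTI; apply: measurable_fun_le => //.
  exact: measurableT_comp.
(* Counts the times u and u + e at which X exceeds M within A. *)
pose bad (p : R * Omega) : R := \1_(B X) p + \1_(B (fun u => X (u + e))) p.
have mbad : measurable_fun setT bad.
  by apply: measurable_funD; apply: measurable_indic; exact: mB.
have bad0 p : 0 <= bad p by rewrite addr_ge0.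
have bad_null u : 0 <= u <= t -> (\int[P]_w (bad (u, w))%:E <= 0%:E)%E.
  move=> /andP[u0 ut].
  have uT : 0 <= u < T by rewrite u0 (le_lt_trans ut).
  have ueT : 0 <= u + e < T.
    by rewrite addr_ge0 ?(ltW e0)// (le_lt_trans _ teT)// lerD2r.
  pose S v := A `&` [set w | M <= `|X v w|].
  have mS v : measurable (S v).
    apply: measurableI => //; rewrite -[X in measurable X]setTI.
    by apply: measurable_fun_le => //; exact: measurableT_comp.
  have ind v : 0 <= v < T -> (\int[P]_w (\1_(S v) w)%:E = 0)%E.
    by move=> vT; rewrite integral_indic// setIT; exact: AM.
  rewrite (_ : (fun w => _) = (fun w => (\1_(S u) w)%:E + (\1_(S (u + e)%R) w)%:E)%E); last first.
    apply/funext => w; rewrite -EFinD /bad !indicE.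
    have -> : ((u, w) \in B X) = (w \in S u) by apply/idP/idP; rewrite !inE.
    have -> // : ((u, w) \in B (fun u => X (u + e))) = (w \in S (u + e)).
    by apply/idP/idP; rewrite !inE.
  rewrite ge0_integralD//; last 2 first.
  - by apply/measurable_EFinP; exact: measurable_indic.
  - by apply/measurable_EFinP; exact: measurable_indic.
  by rewrite !ind// adde0.
have int0 : (\int[P]_w \int[leb]_(u in `[0%R, t]) (bad (u, w))%:E = 0)%E.
  apply/eqP; rewrite eq_le; apply/andP; split.
    by have := integral_section_le t0 (lexx 0) mbad bad0 bad_null; rewrite mul0r.
  by apply: integral_ge0 => w _; apply: integral_ge0 => u _; rewrite lee_fin.
have mI : measurable_fun setT (fun w => \int[leb]_(u in `[0%R, t]) (bad (u, w))%:E)%E.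
  exact: ge0_measurable_integral.
have aeI : {ae P, forall w, (\int[leb]_(u in `[0%R, t]) (bad (u, w))%:E = 0)%E}.
  have /(ae_eq_integral_abs P measurableT mI) : (\int[P]_w
      `|\int[leb]_(u in `[0%R, t]) (bad (u, w))%:E| = 0)%E.
    rewrite -int0; apply: eq_integral => w _; rewrite gee0_abs//.
    by apply: integral_ge0 => u _; rewrite lee_fin.
  by apply: filterS => w /(_ I).
have nt : {ae P, forall w, A w -> `|X t w| <= M} by apply: null_at; rewrite t0 tT.
have n0 : {ae P, forall w, A w -> `|X 0 w| <= M}.
  by apply: null_at; rewrite lexx (le_lt_trans t0).
apply: filterS3 nt n0 aeI => w tw w0 Iw Aw.
rewrite (clip_id (tw Aw)) (clip_id (w0 Aw)); congr (_ - _).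
rewrite /sym_sum; congr (_ * fine _).
have mbadw : measurable_fun setT (fun u => (bad (u, w))%:E).
  by apply/measurable_EFinP; apply: (measurableT_comp mbad (pair2_measurable w)).
have ae_bad : ae_eq leb `[0, t]%classic (fun u => (bad (u, w))%:E) (cst 0%E).
  apply/(ae_eq_integral_abs leb (measurable_itv _)); first exact: measurable_funTS.
  rewrite -[RHS]Iw; apply: eq_integral => u _; rewrite gee0_abs//.
  by rewrite lee_fin.
have mS Y : joint_measurable Y -> measurable_fun `[0, t]%classic (fun u =>
    ((Y (u + e) w - Y u w) * (2^-1 * (g (Y (u + e) w) + g (Y u w))))%:E).
  move=> mY; apply/measurable_EFinP; apply: measurable_funTS.
  exact: (measurableT_comp (measurable_sym_integrand mY e mg) (pair2_measurable w)).
apply: ae_eq_integral => //; first exact: mS.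
  exact: (mS _ (joint_measurable_clip M mX)).
apply: filterS ae_bad => u bad_eq0 uab.
have [badu] : (bad (u, w))%:E = 0%:E := bad_eq0 uab.
have [/negP nu /negP nue] : ~~ ((u, w) \in B X) /\ ~~ ((u, w) \in B (fun u => X (u + e))).
  by move: badu; rewrite /bad !indicE; case: (_ \in _) => /=; case: (_ \in _) => //=; lra.
have Xu : `|X u w| <= M.
  by apply/ltW; rewrite ltNge; apply/negP => h; apply: nu; rewrite inE.
have Xue : `|X (u + e) w| <= M.
  by apply/ltW; rewrite ltNge; apply/negP => h; apply: nue; rewrite inE.
by rewrite !clip_id.
Qed.

Theorem sym_sum_cvg_in_probability X T K (f f1 f2 f3 : R -> R) t (eta : R) :
  joint_measurable X -> fourth_moment_bound P T K X -> 0 <= K ->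
  (forall x, is_derive x 1 f (f1 x)) ->
  (forall x, is_derive x 1 f1 (f2 x)) ->
  (forall x, is_derive x 1 f2 (f3 x)) -> continuous f3 ->
  0 <= t -> t < T -> 0 < eta ->
  P [set w | eta <= `|sym_sum X f1 t e w - (f (X t w) - f (X 0 w))|]
    @[e --> 0^'+] --> 0%E.
Proof.
move=> mX X4 K0 df df1 df2 cf3 t0 tT eta0.
have T0 : 0 < T by exact: le_lt_trans tT.
have cf := is_derive_continuous df; have cf1 := is_derive_continuous df1.
have mf : measurable_fun setT f by exact: continuous_measurable_fun.
have mf1 : measurable_fun setT f1 by exact: continuous_measurable_fun.
have mXu := joint_measurable_l mX.
pose dev (Y : R -> Omega -> R) e w := `|sym_sum Y f1 t e w - (f (Y t w) - f (Y 0 w))|.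
have mdev Y e : joint_measurable Y -> measurable_fun setT (dev Y e).
  move=> mY; have mYu := joint_measurable_l mY.
  apply: measurableT_comp => //; apply: measurable_funB; first exact: measurable_sym_sum.
  by apply: measurable_funB; exact: measurableT_comp.
pose E Y e := [set w | eta <= dev Y e w].
have mE Y e : joint_measurable Y -> measurable (E Y e).
  move=> mY; rewrite -[E Y e]setTI; apply: measurable_fun_le => //.
  exact: mdev.
suff small (kappa : R) : 0 < kappa ->
    \forall e \near 0^'+, (P (E X e) <= kappa%:E)%E.
  apply/fine_cvgP; split.
    by apply: nearW => e; apply: fin_num_measure; exact: mE.
  apply/cvgr0Pnorm_le => kappa k0; apply: filterS (small _ k0) => e.
  rewrite /= ger0_norm ?fine_ge0// -lee_fin fineK//.
  by apply: fin_num_measure; exact: mE.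
move=> k0; have k20 : 0 < kappa / 2 by rewrite divr_gt0.
have [A [M' [mA PA AM']]] := path_bound T0 K0 mXu X4 k20.
pose M := Num.max 0 M'; have M0 : 0 <= M by rewrite le_max lexx.
have AM u : 0 <= u < T -> P (A `&` [set w | M <= `|X u w|]) = 0%E.
  move=> uT; apply/eqP; rewrite eq_le measure_ge0 andbT -(AM' _ uT).
  have mS N : measurable (A `&` [set w | N <= `|X u w|]).
    apply: measurableI => //; rewrite -[X in measurable X]setTI.
    by apply: measurable_fun_le => //; exact: measurableT_comp.
  apply: le_measure; rewrite ?inE//.
  move=> w [Aw /= h]; split => //=; apply: le_trans h.
  by rewrite le_max lexx orbT.
have [H0 f3H0] := continuous_norm_ub M cf3; have [L0 f1L0] := continuous_norm_ub M cf1.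
pose H := Num.max 0 H0; pose L := Num.max 0 L0.
have f3H x : `|x| <= M -> `|f3 x| <= H.
  by move=> /f3H0 h; rewrite (le_trans h)// le_max lexx orbT.
have f1L x : `|x| <= M -> `|f1 x| <= L.
  by move=> /f1L0 h; rewrite (le_trans h)// le_max lexx orbT.
pose C := (1 + K) * (H * t + 2 * L).
have C0 : 0 <= C.
  by rewrite mulr_ge0 ?addr_ge0 ?mulr_ge0// /H /L le_max lexx.
pose Y u w := clip M (X u w).
have mY : joint_measurable Y by exact: joint_measurable_clip.
have Y4 : fourth_moment_bound P T K Y by exact: fourth_moment_bound_clip.
(* For sqrt e <= s0, Markov's inequality gives C * s0 / eta <= kappa / 2. *)
pose s0 := eta * (kappa / 2) / (C + 1).
have s00 : 0 < s0 by rewrite divr_gt0 ?mulr_gt0// ltr_wpDl.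
near=> e.
have e0 : 0 < e by [].
have teT : t + e < T.
  by rewrite -ltrBrDl; near: e; apply: nbhs_right_lt; rewrite subr_gt0.
have es0 : Num.sqrt e <= s0.
  rewrite -[leRHS]ger0_norm ?(ltW s00)// -sqrtr_sqr ler_wsqrtr//.
  by near: e; apply: nbhs_right_le; rewrite exprn_gt0.
have PY : (P (E Y e) <= (kappa / 2)%:E)%E.
  have devY0 w : 0 <= dev Y e w by rewrite /dev normr_ge0.
  apply: (le_trans (ge0_markov P (mdev Y e mY) devY0 eta0)).
  rewrite lee_pdivrMl//.
  apply: le_trans (sym_sum_bounded_L1 mY Y4 K0 _ df df1 df2 _ _ f3H f1L t0 e0 (ltW teT)) _ => //.
  - by move=> u w; exact: clip_bounded.
  - by rewrite le_max lexx.
  - by rewrite le_max lexx.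
  rewrite -EFinM lee_fin -/C (@le_trans _ _ (C * s0))//; first exact: ler_wpM2l.
  rewrite /s0 mulrA ler_pdivrMr ?ltr_wpDl// [leLHS]mulrC ler_wpM2l ?lerDl//.
  exact: mulr_ge0 (ltW eta0) (ltW k20).
have [N [mN N0 subN]] := sym_sum_clip f mX mA mf1 M0 AM t0 e0 teT.
have sub : E X e `<=` ~` A `|` E Y e `|` N.
  move=> w /= Xw; have [Aw|nA] := pselect (A w); last by left; left.
  have [XY|nXY] := pselect (sym_sum X f1 t e w - (f (X t w) - f (X 0 w)) =
    sym_sum Y f1 t e w - (f (Y t w) - f (Y 0 w))).
    by left; right; rewrite /E/= /dev -XY.
  by right; apply: subN => /(_ Aw).
have mAY : measurable (~` A `|` E Y e).
  by apply: measurableU; [exact: measurableC|exact: mE].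
apply: (le_trans (le_measure P _ _ sub)); rewrite ?inE//; [exact: mE|exact: measurableU|].
apply: (le_trans (measureU2 _ mAY mN)).
rewrite [X in (_ + X <= _)%E]N0 adde0.
apply: (le_trans (measureU2 _ (measurableC mA) (mE _ _ mY))).
by rewrite [kappa]splitr EFinD leeD.
Unshelve. all: by end_near. Qed.

End Localization.

(** * The canonical metric of the process *)

Section CenteredGaussian.
Context {R : realType} d (Omega : measurableType d) (P : probability Omega R).
Variables (T : R) (X : R -> {RV P >-> R}).
Hypothesis hX : centered_gaussian_process T X.
Implicit Types (s t u v : R).

Let mX u : measurable_fun setT (X u). Proof. exact: measurable_funPT. Qed.

Lemma gaussian_value u : u \in `[0, T] -> exists m sigma, normal_rv P (X u) m sigma.
Proof.
move=> uT; have [gX _] := hX.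
have [m [s n1]] := gX 1%N (fun=> u) (fun=> 1) (fun=> uT).
exists m, s; rewrite (_ : (X u : Omega -> R) = (fun w => \sum_(i < 1) 1 * X u w))//.
by apply/funext => w; rewrite big_ord1 mul1r.
Qed.

Lemma gaussian_increment s t : s \in `[0, T] -> t \in `[0, T] ->
  exists m sigma, normal_rv P (fun w => X t w - X s w) m sigma.
Proof.
move=> sT tT; have [gX _] := hX.
pose r (i : 'I_2) := if val i == 0%N then t else s.
pose c (i : 'I_2) : R := if val i == 0%N then 1 else -1.
have rT i : r i \in `[0, T] by rewrite /r; case: ifP.
have [m [sg n2]] := gX 2%N r c rT.
exists m, sg; rewrite (_ : (fun w => _) = (fun w => \sum_(i < 2) c i * X (r i) w))//.
by apply/funext => w; rewrite !big_ord_recl big_ord0 /r/c /= mul1r mulN1r addr0.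
Qed.

Lemma integrable_mul u v : u \in `[0, T] -> v \in `[0, T] ->
  P.-integrable setT (EFin \o (fun w => X u w * X v w)).
Proof.
have sq z : z \in `[0, T] -> P.-integrable setT (EFin \o (fun w => X z w ^+ 4)).
  move=> zT; have [m [sg nz]] := gaussian_value zT.
  apply/integrableP; split; first by apply/measurable_EFinP; exact: measurable_funX.
  under eq_integral do rewrite /= ger0_norm ?exprn_even_ge0//.
  by rewrite (le_lt_trans (normal_rv_fourth_moment_le (mX z) nz))// ltry.
have i1 : P.-integrable setT (EFin \o cst (1 : R)).
  exact: finite_measure_integrable_cst.
move=> uT vT.
apply: (le_integrable measurableT _ _
  (integrableD measurableT i1 (integrableD measurableT (sq _ uT) (sq _ vT)))).
  by apply/measurable_EFinP; exact: measurable_funM.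
move=> w _ /=; rewrite lee_fin.
have p4 (x : R) : 0 <= x ^+ 4 by rewrite exprn_even_ge0.
rewrite [leRHS]ger0_norm ?addr_ge0//.
move: (X u w) (X v w) => x y.
have sqle (z : R) : 2 * z ^+ 2 <= z ^+ 4 + 1.
  rewrite -subr_ge0 (_ : _ - _ = (z ^+ 2 - 1) ^+ 2) ?sqr_ge0//; ring.
have := sqle x; have := sqle y.
have := sqr_ge0 (x - y); have := sqr_ge0 (x + y); rewrite sqrrB sqrrD.
by rewrite ler_norml; move: (x ^+ 4) (y ^+ 4) (p4 x) (p4 y) => X4 Y4 *;
  apply/andP; split; lra.
Qed.

Lemma covarE s t : covar X s t = \int[P]_w (X s w * X t w).
Proof. by rewrite /covar unlock. Qed.

Lemma varE u : u \in `[0, T] -> var X u = covar X u u.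
Proof.
move=> uT; have [_ EX0] := hX.
rewrite /var /variance unlock EX0//=; congr (fine 'E_P[_]).
by apply/funext => w; rewrite !fctE /= !subr0.
Qed.

Lemma delta2E s t : s \in `[0, T] -> t \in `[0, T] ->
  delta2 X s t = var X t - covar X s t *+ 2 + var X s.
Proof.
move=> sT tT; rewrite !varE// !covarE /delta2 unlock.
have itt := integrable_mul tT tT; have iss := integrable_mul sT sT.
have ist := integrable_mul sT tT.
transitivity (\int[P]_w (X t w * X t w - (X s w * X t w) *+ 2 + X s w * X s w)).
  by apply: eq_Rintegral => w _; rewrite expr2; ring.
have ist2 : P.-integrable setT (EFin \o (fun w => (X s w * X t w) *+ 2)).
  rewrite (_ : _ \o _ = (EFin \o (fun w => (X s w * X t w)%R)) \+
    (EFin \o (fun w => (X s w * X t w)%R)))%E; last first.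
    by apply/funext => w /=; rewrite mulr2n EFinD.
  exact: integrableD.
rewrite RintegralD//; last exact: (integrableB _ itt ist2).
rewrite RintegralB//; congr (_ - _ + _).
rewrite mulr2n -RintegralD//.
Qed.

Lemma var_ge0 u : u \in `[0, T] -> 0 <= var X u.
Proof.
move=> uT; rewrite varE// covarE; apply: Rintegral_ge0 => w _.
by rewrite -expr2 sqr_ge0.
Qed.

Lemma delta2_ge0 s t : 0 <= delta2 X s t.
Proof.
by rewrite /delta2 unlock; apply: Rintegral_ge0 => w _; rewrite sqr_ge0.
Qed.

Lemma delta2xx s : delta2 X s s = 0.
Proof.
rewrite /delta2 unlock (eq_integral (cst 0%E)) ?integral0// => w _ /=.
by rewrite subrr expr0n.
Qed.

(** The difference of the two sides is the square of
    [var X u - covar X u v]. *)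
Lemma gram_le u v : u \in `[0, T] -> v \in `[0, T] ->
  var X u * var X v - covar X u v ^+ 2 <= var X u * delta2 X u v.
Proof.
move=> uT vT; rewrite delta2E//.
have := sqr_ge0 (var X u - covar X u v).
by rewrite !expr2; lra.
Qed.

Lemma gaussian_fourth_moment_bound : exists2 C : R, 0 <= C &
  forall s t, s \in `[0, T] -> t \in `[0, T] ->
    (\int[P]_w ((X t w - X s w) ^+ 4)%:E <= (C * delta2 X s t ^+ 2)%:E)%E.
Proof.
exists (8 * (64 * 8 ^+ 2 + 1042 ^+ 2)).
  by rewrite mulr_ge0 ?addr_ge0 ?mulr_ge0 ?exprn_ge0 ?ler0n.
move=> s t sT tT; have [m [sg nst]] := gaussian_increment sT tT.
have mD : measurable_fun setT (fun w => X t w - X s w) by exact: measurable_funB.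
by have := normal_rv_fourth_moment_le mD nst; rewrite /delta2 unlock.
Qed.

End CenteredGaussian.

Section CanonicalMetric.
Context {R : realType}.
Implicit Types (u v w r x y l : R).

Lemma concave_on_le (D : set R) (f : R -> R) x y l : concave_on D f ->
  x \in D -> y \in D -> 0 <= l <= 1 ->
  l * f x + (1 - l) * f y <= f (l * x + (1 - l) * y).
Proof.
move=> cf xD yD /andP[l0 l1].
have : - f (l * x + (1 - l) * y) <= l * (- f x) + (1 - l) * (- f y).
  exact: (cf (Itv01 l0 l1) x y xD yD).
by rewrite !mulrN; lra.
Qed.

(** Any positive power [p] serves: only the convergence of [delta] to 0 is
    extracted. *)
Lemma littleo_sqr_small (delta : R -> R) (p eta : R) : 0 < p ->
  delta =o_ (0^'+) (fun r => r `^ p) -> 0 < eta ->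
  \forall r \near 0^'+, delta r ^+ 2 <= eta.
Proof.
move=> p0 /eqoP deltao eta0.
pose k := Num.min 1 eta; have k0 : 0 < k by rewrite lt_min ltr01.
near=> r.
have r0 : 0 < r by [].
have r1 : r <= 1 by near: r; apply: nbhs_right_le.
have rp1 : r `^ p <= 1.
  have <- : 1 `^ p = 1 :> R by rewrite powR1.
  by rewrite ge0_ler_powR ?nnegrE ?(ltW p0) ?(ltW r0).
have : `|delta r| <= k * `|r `^ p| by near: r; exact: deltao.
rewrite (ger0_norm (powR_ge0 _ _)) => dk.
have {dk} : `|delta r| <= k.
  by rewrite (le_trans dk)// ler_piMr// ltW.
rewrite -real_normK ?num_real// => dk.
have k1 : k <= 1 by rewrite ge_min lexx.
have ke : k <= eta by rewrite ge_min lexx orbT.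
apply: le_trans ke; rewrite expr2 -[leRHS]mulr1.
by rewrite ler_pM// (le_trans dk).
Unshelve. all: by end_near. Qed.

(** A convex function between [0] and [v] that has limit at most 0 at [v] lies
    below the chord from [(0, D 0)] to [(v, 0)]. *)
Lemma convex_vanishing_le (D : R -> R) v w :
  concave_on `[0, v[ (fun u => - D u) -> 0 <= D 0 ->
  (forall eta, 0 < eta -> \forall r \near 0^'+, D (v - r) <= eta) ->
  0 <= w -> w < v -> D w <= (1 - w / v) * D 0.
Proof.
move=> cD D0 Dv w0 wv; have v0 : 0 < v by exact: le_lt_trans wv.
apply/ler_addgt0Pr => eta eta0.
near (0:R)^'+ => r.
have r0 : 0 < r by [].
have rvw : r < v - w by near: r; apply: nbhs_right_lt; rewrite subr_gt0.
have Dr : D (v - r) <= eta by near: r; exact: Dv.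
have u0 : 0 < v - r by lra.
pose l := 1 - w / (v - r).
have wu : w / (v - r) <= 1 by rewrite ler_pdivrMr// mul1r; lra.
have wu0 : 0 <= w / (v - r) by rewrite divr_ge0// ltW.
have wvu : w / v <= w / (v - r).
  by rewrite ler_wpM2l// lef_pV2 ?posrE//; lra.
have l01 : 0 <= l <= 1 by rewrite /l; apply/andP; split; lra.
have i0 : 0 \in `[0, v[%classic by rewrite inE/= in_itv/= lexx.
have iu : v - r \in `[0, v[%classic.
  by rewrite inE/= in_itv/=; apply/andP; split; lra.
have := concave_on_le cD i0 iu l01.
rewrite mulr0 add0r (_ : (1 - l) * (v - r) = w); last first.
  by rewrite /l; field; rewrite gt_eqF.
rewrite /l; set q := w / (v - r) in l l01 wu wu0 wvu *.
have : (1 - q) * D 0 <= (1 - w / v) * D 0 by rewrite ler_wpM2r//; lra.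
have : (1 - (1 - q)) * D (v - r) <= 1 * eta.
  have [Dneg|Dpos] := leP (D (v - r)) 0.
    by rewrite (@le_trans _ _ 0)// ?mul1r ?(ltW eta0)// mulr_ge0_le0//; lra.
  by rewrite ler_pM//; lra.
by rewrite !mulrN; lra.
Unshelve. all: by end_near. Qed.

Context d (Omega : measurableType d) (P : probability Omega R).

(** The point [u = 1 / (2 a)] is used in (ii) and (iii): there [a * u <= 1],
    and the strict inequality (iii) excludes [delta u = 0].  In (ii) with
    [v = u + r] the left side is a positive multiple of [delta r ^ 2], and the
    right side is at most a multiple of [delta2 u (u + r)], hence of [r]. *)
Lemma canonical_metric_linear (T : R) (X : R -> {RV P >-> R}) (delta : R -> R)
    (a b c' : R) :
  centered_gaussian_process T X -> 1 <= T ->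
  (forall r, r \in `[0, T] -> 0 <= delta r) ->
  increasing_on `[0, T] (fun r => delta r ^+ 2) ->
  delta =o_ (0^'+) (fun r => r `^ (1 / 6)) ->
  (forall s t, s \in `[0, T] -> t \in `[0, T] ->
     delta2 X s t <= delta `|t - s| ^+ 2) ->
  (forall v, v \in `[0, T] -> concave_on `[0, v[ (fun u => - delta2 X u v)) ->
  1 < a -> 0 < c' ->
  (\forall e \near 0^'+, forall u v, e < u -> u < v -> v <= 1 ->
     c' * delta u ^+ 2 * delta (v - u) ^+ 2
     <= var X u * var X v - covar X u v ^+ 2) ->
  (\forall e \near 0^'+, forall u v, e < u -> u < v -> v <= 1 -> a * u <= T ->
     (delta (a * u) - delta u) / ((a - 1) * u) < b * (delta u / u)) ->
  exists2 K : R, 0 <= K & forall s t, s \in `[0, T] -> t \in `[0, T] ->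
    delta2 X s t <= K * `|t - s|.
Proof.
move=> hX T1 delta0 delta_incr deltao delta_dom left_conc a1 c0 hii hiii.
have a0 : 0 < a by lra.
have aV1 : a^-1 < 1 by rewrite invf_lt1.
have aV0 : 0 < a^-1 by rewrite invr_gt0.
pose u := a^-1 / 2; have u0 : 0 < u by rewrite /u; lra.
have u2 : u < 1 / 2 by rewrite /u; lra.
have au : a * u = 1 / 2 by rewrite /u; field; rewrite gt_eqF.
have uT : u \in `[0, T] by rewrite in_itv/=; apply/andP; split; lra.
have delta_u : delta u != 0.
  apply/eqP => du0.
  have [e []] : exists e, e < u /\ forall u v, e < u -> u < v -> v <= 1 -> a * u <= T ->
     (delta (a * u) - delta u) / ((a - 1) * u) < b * (delta u / u).
    apply: (@filter_ex _ (0^'+ : set_system R)).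
    by near=> e; split; [near: e; exact: nbhs_right_lt|near: e; exact: hiii].
  move=> eu /(_ u 1 eu); rewrite au du0 mul0r mulr0 subr0.
  have -> : (u < 1) = true by lra.
  have -> : (1 / 2 <= T) = true by lra.
  move=> /(_ isT (lexx _) isT).
  have half0 : 0 <= delta (1 / 2).
    by apply: delta0; rewrite in_itv/=; apply/andP; split; lra.
  have a10 : 0 <= (a - 1) * u by rewrite mulr_ge0 ?(ltW u0)//; lra.
  by rewrite ltNge divr_ge0.
have du2 : 0 < delta u ^+ 2 by rewrite exprn_even_gt0//=.
have inT s r : 0 <= s -> s <= r -> r <= T -> s \in `[0, T].
  by move=> s0 sr rT; rewrite in_itv/=; apply/andP; split; lra.
have dT : 0 <= delta T ^+ 2 by rewrite sqr_ge0.
have delta_le r : 0 <= r -> r <= T -> delta r ^+ 2 <= delta T ^+ 2.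
  move=> r0 rT; apply: delta_incr => //.
  - by rewrite inE/=; exact: (inT r r).
  - by rewrite inE/=; apply: (inT T T); lra.
(* delta2 _ v lies below its chord from 0 to v. *)
have hconv w v : 0 <= w -> w < v -> v <= T ->
    delta2 X w v <= (1 - w / v) * delta T ^+ 2.
  move=> w0 wv vT; have v0 : 0 < v by exact: le_lt_trans wv.
  have vT' : v \in `[0, T] by apply: (inT v v); lra.
  have zT : 0 \in `[0, T] by apply: (inT 0 v); lra.
  apply: (@le_trans _ _ ((1 - w / v) * delta2 X 0 v)); last first.
    have wv1 : w / v <= 1 by rewrite ler_pdivrMr// mul1r ltW.
    rewrite ler_wpM2l//; first by lra.
    rewrite (le_trans (delta_dom _ _ zT vT'))// subr0 delta_le//.
    by rewrite ger0_norm// ltW.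
  apply: (@convex_vanishing_le (fun u => delta2 X u v)) => //.
  - exact: left_conc.
  - exact: delta2_ge0.
  move=> eta eta0; near=> r.
  have r0 : 0 < r by [].
  have rv : r < v by near: r; exact: nbhs_right_lt.
  apply: (@le_trans _ _ (delta r ^+ 2)).
    have vrT : v - r \in `[0, T] by apply: (inT (v - r) v); lra.
    have := delta_dom _ _ vrT vT'.
    by rewrite (_ : v - (v - r) = r) ?ger0_norm ?(ltW r0)//; ring.
  by near: r; apply: littleo_sqr_small deltao eta0; lra.
have [e [eu hii']] : exists e, e < u /\ forall u v, e < u -> u < v -> v <= 1 ->
     c' * delta u ^+ 2 * delta (v - u) ^+ 2
     <= var X u * var X v - covar X u v ^+ 2.
  apply: (@filter_ex _ (0^'+ : set_system R)).
  by near=> e; split; [near: e; exact: nbhs_right_lt|near: e; exact: hii].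
have cd : 0 < c' * delta u ^+ 2 by rewrite mulr_gt0.
have Qu := var_ge0 hX uT.
pose K1 := var X u * (delta T ^+ 2 / u) / (c' * delta u ^+ 2).
have K10 : 0 <= K1.
  by rewrite /K1 divr_ge0 ?(ltW cd)// mulr_ge0// divr_ge0// ltW.
have small r : 0 < r -> r <= 1 / 2 -> delta r ^+ 2 <= K1 * r.
  move=> r0 r2.
  have v0 : 0 < u + r by lra.
  have vT : u + r \in `[0, T] by apply: (inT (u + r) (u + r)); lra.
  have := hii' u (u + r) eu; rewrite addrAC subrr add0r.
  have -> : (u < u + r) = true by lra.
  have -> : (u + r <= 1) = true by lra.
  move=> /(_ isT isT) h.
  have h2 := le_trans h (gram_le hX uT vT).
  rewrite /K1 mulrAC ler_pdivlMr// mulrC (le_trans h2)// -mulrA ler_wpM2l//.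
  have -> : delta T ^+ 2 / u * r = r / u * delta T ^+ 2 by ring.
  have h3 : delta2 X u (u + r) <= (1 - u / (u + r)) * delta T ^+ 2.
    by apply: hconv; lra.
  rewrite (le_trans h3)// ler_wpM2r//.
  rewrite (_ : 1 - u / (u + r) = r / (u + r)); last by field; rewrite gt_eqF.
  by rewrite ler_wpM2l ?(ltW r0)// lef_pV2 ?posrE//; lra.
exists (K1 + 2 * delta T ^+ 2); first by lra.
move=> s t sT tT.
have [->|st] := eqVneq s t; first by rewrite delta2xx subrr normr0 mulr0.
have ts0 : 0 < `|t - s| by rewrite normr_gt0 subr_eq0 eq_sym.
rewrite (le_trans (delta_dom _ _ sT tT))//.
have tsT : `|t - s| <= T.
  move: sT tT; rewrite !in_itv/= => /andP[? ?] /andP[? ?].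
  by rewrite ler_norml; apply/andP; split; lra.
rewrite mulrDl; set r := `|t - s| in ts0 tsT *.
have [r2|r2] := leP r (1 / 2).
  rewrite (le_trans (small _ ts0 r2))// lerDl mulr_ge0 ?(ltW ts0)//; lra.
rewrite (le_trans (delta_le _ (ltW ts0) tsT))//.
apply: (@le_trans _ _ (2 * delta T ^+ 2 * r)).
  by rewrite -mulrA mulrCA -[leLHS]mulr1 ler_wpM2l//; lra.
by rewrite lerDr mulr_ge0// ltW.
Unshelve. all: by end_near. Qed.

End CanonicalMetric.

(** * Ito's formula *)

Theorem corollary15 (R : realType) (dO : measure_display)
  (Omega : measurableType dO) (P : probability Omega R)
  (eps0 : R) (heps0 : 0 < eps0)
  (W : R -> {RV P >-> R}) (hW : brownian_motion (1 + eps0) W)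
  (G : R -> R -> R)
  (hGm : measurable_fun (`[0, 1 + eps0] `*` `[0, 1 + eps0])
           (fun p : R * R => G p.1 p.2))
  (hG2 : forall t : R, t \in `[0, 1 + eps0] ->
     lebesgue_measure.-integrable `[0, 1 + eps0]
       (fun s : R => ((G t s) ^+ 2)%:E))
  (X : R -> {RV P >-> R})
  (hX : centered_gaussian_process (1 + eps0) X)
  (hXG : forall t : R, t \in `[0, 1 + eps0] ->
     wiener_integral (1 + eps0) W (G t) (X t))
  (hXm : measurable_fun (`[0, 1 + eps0] `*` setT)
           (fun p : R * Omega => X p.1 p.2))
  (delta : R -> R)
  (hdelta_ge0 : forall r : R, r \in `[0, 1 + eps0] -> 0 <= delta r)
  (hdelta_incr : increasing_on `[0, 1 + eps0] (fun r => delta r ^+ 2))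
  (hdelta_conc : concave_on `[0, 1 + eps0] (fun r => delta r ^+ 2))
  (hdelta_o : delta =o_ (0^'+) (fun r => r `^ (1 / 6)))
  (hdelta_bound : forall s t : R, s \in `[0, 1 + eps0] -> t \in `[0, 1 + eps0] ->
     delta2 X s t <= delta `|t - s| ^+ 2)
  (mu : signed_measure (R * R)%type R)
  (hmu : mixed_derivative_off_diagonal (1 + eps0)
           (fun p => delta2 X p.1 p.2) mu)
  (C : R)
  (hmu_bound : \forall e \near 0^'+,
     (variation_measure mu
        [set p : R * R | [/\ (0 <= p.1)%R, (p.1 <= p.2 - e)%R
                           & (p.2 - e <= 1)%R]]
      <= (C * e `^ (- (2 / 3)))%:E)%E)
  (hQ_incr : increasing_on `[0, 1 + eps0] (var X))
  (hQ_conc : concave_on `[0, 1 + eps0] (var X))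
  (hright_incr : forall u : R, u \in `[0, 1 + eps0] ->
     increasing_on `]u, 1 + eps0] (fun v => delta2 X u v))
  (hright_conc : forall u : R, u \in `[0, 1 + eps0] ->
     concave_on `]u, 1 + eps0] (fun v => delta2 X u v))
  (hleft_incr : forall v : R, v \in `[0, 1 + eps0] ->
     increasing_on `[0, v[ (fun u => - delta2 X u v))
  (hleft_conc : forall v : R, v \in `[0, 1 + eps0] ->
     concave_on `[0, v[ (fun u => - delta2 X u v))
  (a b c c' : R) (ha : 1 < a) (hb0 : 0 < b) (hb : b < 1 / 2)
  (hc : 1 / 4 < c) (hc' : 0 < c')
  (hi : \forall e \near 0^'+, forall u v, e < u -> u < v -> v <= 1 ->
     c * delta u ^+ 2 <= var X u)
  (hii : \forall e \near 0^'+, forall u v, e < u -> u < v -> v <= 1 ->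
     c' * delta u ^+ 2 * delta (v - u) ^+ 2
     <= var X u * var X v - covar X u v ^+ 2)
  (hiii : \forall e \near 0^'+, forall u v, e < u -> u < v -> v <= 1 ->
     a * u <= 1 + eps0 ->
     (delta (a * u) - delta u) / ((a - 1) * u) < b * (delta u / u))
  (f : R -> R) (hf : Cn 6 f)
  (t : R) (ht : t \in `[0, 1]) :
  exists I : {RV P >-> R},
    symmetric_integral X (f^`())%classic t I /\
    {ae P, forall w, f (X t w) = f (X 0 w) + I w}.

Proof.
pose T := 1 + eps0; have T1 : 1 < T by rewrite ltrDl.
have T0 : 0 < T by lra.
have t01 : 0 <= t <= 1 by move: ht; rewrite in_itv.
have itvE (s : R) : 0 <= s <= T -> s \in `[0, T] by rewrite in_itv.
have [K K0 linear] := canonical_metric_linear hX (ltW T1) hdelta_ge0 hdelta_incr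
  hdelta_o hdelta_bound hleft_conc ha hc' hii hiii.
have [C4 C40 moment] := gaussian_fourth_moment_bound hX.
(* Joint measurability of X is known on [0, T] only. *)
pose X' (u : R) (w : Omega) : R := if u \in `[0, T] then X u w else 0.
have X'E u : 0 <= u <= T -> X' u = X u.
  by move=> uT; apply/funext => w; rewrite /X' itvE.
have mX' : joint_measurable X'.
  have := hXm => /(measurable_restrictT _ (measurableX (measurable_itv _) measurableT)).
  rewrite /joint_measurable; congr measurable_fun; apply/funext => p.
  rewrite patchE /X'; congr (if _ then _ else _).
  by apply/idP/idP => [|pT]; rewrite inE/=; [case|split].
have X'4 : fourth_moment_bound P T (C4 * K ^+ 2) X'.
  move=> s r sT rT; rewrite (X'E s sT) (X'E r rT).
  rewrite (le_trans (moment s r (itvE _ sT) (itvE _ rT)))// lee_fin.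
  rewrite -mulrA ler_wpM2l// -[(r - s) ^+ 2]real_normK ?num_real// -exprMn.
  rewrite lerXn2r ?nnegrE ?delta2_ge0 ?mulr_ge0//.
  exact: linear (itvE _ sT) (itvE _ rT).
have df k : (k < 6)%N -> forall x : R, is_derive x 1 (f^`(k))%classic (f^`(k.+1)%classic x).
  exact: Cn_is_derive hf.
have mf : measurable_fun setT f.
  apply: continuous_measurable_fun; exact: (is_derive_continuous (df 0%N isT)).
have mI : measurable_fun setT (fun w => f (X t w) - f (X 0 w)).
  have mfX u : measurable_fun setT (f \o X u) by exact: measurableT_comp.
  exact: measurable_funB (mfX t) (mfX 0).
pose I : {RV P >-> R} := HB.pack (fun w => f (X t w) - f (X 0 w))
  (isMeasurableFun.Build _ _ _ _ _ mI).
exists I; split; last by apply: aeW => w /=; rewrite addrC subrK.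
move=> eta eta0.
have := @sym_sum_cvg_in_probability R _ _ P X' T (C4 * K ^+ 2) f (f^`(1))%classic (f^`(2))%classic
  (f^`(3))%classic t eta mX' X'4 (mulr_ge0 C40 (sqr_ge0 K)) (df 0%N isT) (df 1%N isT) (df 2%N isT)
  (is_derive_continuous (df 3%N isT)) (proj1 (andP t01)) (le_lt_trans (proj2 (andP t01)) T1) eta0.
apply: cvg_trans; apply: near_eq_cvg.
near=> e.
have e0 : 0 < e by [].
have ee : e <= eps0 by near: e; exact: nbhs_right_le.
congr (P _).
apply: (congr1 (fun h => [set w | eta <= `|h w|])
  (_ : (fun w => sym_sum X' (f^`(1))%classic t e w - (f (X' t w) - f (X' 0 w))) =
       (fun w => symmetric_sum X (f^`())%classic t e w - I w))).
apply/funext => w.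
have [t0 t1] := andP t01.
have X't : X' t = X t by apply: X'E; apply/andP; split; lra.
have X'0 : X' 0 = X 0 by apply: X'E; apply/andP; split; lra.
have E : sym_sum X' (f^`(1))%classic t e w = symmetric_sum X (f^`())%classic t e w.
  apply: (congr1 ( *%R e^-1)); apply: eq_Rintegral => u.
  rewrite inE/= in_itv/= => /andP[u0 ut].
  have X'u : X' u = X u by apply: X'E; apply/andP; split; rewrite /T; lra.
  have X'ue : X' (u + e) = X (u + e) by apply: X'E; apply/andP; split; rewrite /T; lra.
  by rewrite X'u X'ue.
by rewrite E X't X'0.
Unshelve. all: by end_near. Qed.
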